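(* For any $\chi\in\mathcal{N}_{\mathbb{R}}$, we have $\mathrm{IN}(\mathrm{FS}(\chi))=\chi^{\mathrm{hom}}$.
   Context: Setting. $k$ is an algebraically closed field (any characteristic), $X$ is a projective variety over $k$ (reduced and irreducible), and $L$ is an ample $\mathbb{Q}$-line bundle on $X$. Norms. A norm on a $k$-vector space $V$ is a function $\chi\colon V\to\mathbb{R}\cup\{+\infty\}$ with $\chi(v)=+\infty$ iff $v=0$, $\chi(av)=\chi(v)$ for $a\in k^\times$, and $\chi(v+w)\ge\min\{\chi(v),\chi(w)\}$. A norm on a graded $k$-algebra $R=\bigoplus_{m\ge 0}R_m$ is a vector space norm such that $\chi(fg)\ge\chi(f)+\chi(g)$, $\chi(\sum_m s_m)=\min_m\chi(s_m)$ for $s_m\in R_m$, and there is $C>0$ with $|\chi|\le Cm$ on $R_m\setminus\{0\}$ for all $m\ge 1$. For $m$ such that $mL$ is a line bundle put $R_m:=H^0(X,mL)$, and put $R^{(d)}:=\bigoplus_m R_{md}$ if $dL$ is a line bundle. $\mathcal{N}_{\mathbb{R}}$ is the direct limit (over $d$ ordered by divisibility, under restriction) of the sets of norms on $R^{(d)}$; its elements are represented by a norm on some $R^{(d)}$, two such being identified if they coincide on some further $R^{(d')}$. So $\chi\in\mathcal{N}_{\mathbb{R}}$ is defined on $R_m$ for $m$ sufficiently divisible. All limits over $m$ are with respect to divisibility. Homogenization. For $\chi\in\mathcal{N}_{\mathbb{R}}$ represented by a norm on $R^{(d)}$, $\chi^{\mathrm{hom}}\in\mathcal{N}_{\mathbb{R}}$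 is the class of the norm $f\mapsto\lim_{r\to\infty}\frac1r\chi(f^r)=\sup_{r\ge1}\frac1r\chi(f^r)$ on $R^{(d)}$; it is independent of the representative. Berkovich space. $X^{\mathrm{an}}$ is the Berkovich analytification of $X$ with respect to the trivial absolute value on $k$, a compact Hausdorff space whose points are semivaluations $v$ on $X$ (real-valued valuations, trivial on $k$, on the function field of a closed subvariety). For a section $s$ of a line bundle, $v(s)\in[0,+\infty]$ is defined by trivializing the line bundle at the center of $v$, and $|s|(v)=e^{-v(s)}$. Operators. For $\chi\in\mathcal{N}_{\mathbb{R}}$, the bounded function $\mathrm{FS}(\chi)\colon X^{\mathrm{an}}\to\mathbb{R}$ is the pointwise limit (= supremum) over sufficiently divisible $m$ of $m^{-1}\sup_{s\in R_m\setminus\{0\}}\{\log|s|+\chi(s)\}$. For a bounded function $\varphi\colon X^{\mathrm{an}}\to\mathbb{R}$, the infimum norm $\mathrm{IN}(\varphi)\in\mathcal{N}_{\mathbb{R}}$ is defined by $\mathrm{IN}(\varphi)(s)=\inf_{v\in X^{\mathrm{an}}}\{v(s)+m\varphi(v)\}$ for $s\in R_m$. *)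

(* Defs.v *)
From HB Require Import structures.
From mathcomp Require Import all_boot all_order all_algebra.
From mathcomp Require Import all_classical all_reals all_analysis.

Set Implicit Arguments.
Unset Strict Implicit.
Unset Printing Implicit Defensive.

Import Order.TTheory GRing.Theory Num.Theory.

Local Open Scope classical_set_scope.
Local Open Scope ring_scope.

(** * Projective varieties

    A projective variety X in P^n over k is encoded by the homogeneous
    coordinates [x_0 : ... : x_n] of its generic point in its function field K,
    and its scheme points are identified with their local rings, seen as
    subrings of K (distinct points have distinct local rings because X is
    separated). This is the "projective model" of Chevalley and Zariski-Samuel:
    X is covered by the affine varieties with coordinate rings
    k[x_0 / x_i, ..., x_n / x_i], for x_i <> 0. *)

Section Models.
Variables (k K : fieldType) (iota : {rmorphism k -> K}).

Definition is_subalg (A : set K) : Prop :=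
  [/\ forall a, A (iota a),
      forall f g, A f -> A g -> A (f - g) &
      forall f g, A f -> A g -> A (f * g)].

Definition is_prime_ideal (A p : set K) : Prop :=
  [/\ p `<=` A, p 0 /\ ~ p 1,
      forall f g, p f -> p g -> p (f + g),
      forall a f, A a -> p f -> p (a * f) &
      forall f g, A f -> A g -> p (f * g) -> p f \/ p g].

Definition localize (A p : set K) : set K :=
  [set f | exists a b, [/\ A a, A b, ~ p b & f = a / b]].

Definition is_unit_in (O : set K) (f : K) : Prop := [/\ f != 0, O f & O f^-1].

Definition max_ideal (O : set K) : set K := [set f | O f /\ ~ is_unit_in O f].

Definition chart n (x : 'I_n.+1 -> K) (i : 'I_n.+1) : set K :=
  smallest is_subalg (range (fun j => x j / x i)).

Definition proj_model n (x : 'I_n.+1 -> K) : set (set K) :=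
  [set O | exists i p, [/\ x i != 0, is_prime_ideal (chart x i) p &
                          O = localize (chart x i) p]].

End Models.

Record projVariety (k : closedFieldType) := ProjVariety {
  funField : fieldType;
  kconst : {rmorphism k -> funField};
  pdim : nat;
  hcoord : 'I_pdim.+1 -> funField;
  hcoord_neq0 : exists i, hcoord i != 0;
  funFieldP : forall i, hcoord i != 0 ->
    localize (chart kconst hcoord i) [set 0] = [set: funField]
}.

Section Variety.
Variables (k : closedFieldType) (X : projVariety k).
Local Notation K := (funField X).

Definition points : set (set K) := proj_model (kconst X) (@hcoord k X).

(** The sets of points at which given rational functions f_1, ..., f_r are
    regular form a basis of the Zariski topology of X. *)
Definition zariski_basic (fs : seq K) : set (set K) :=
  [set O | points O /\ forall f, f \in fs -> O f].

(** ** Line bundles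

    As X is integral, every line bundle is isomorphic to an invertible subsheaf
    of the constant sheaf K, i.e. comes from a Cartier divisor. It is given here
    by a local frame [frame O] in K at each point: the stalk at the point with
    local ring O is [frame O * O], and [frame O] is still a frame at all points
    of a Zariski neighbourhood. *)
Record lineBundle := LineBundle {
  frame : set K -> K;
  frame_neq0 : forall O, points O -> frame O != 0;
  frameP : forall O, points O -> exists fs : seq K,
    zariski_basic fs O /\
    forall O', zariski_basic fs O' -> is_unit_in O' (frame O / frame O')
}.

(** Global sections of the e-th tensor power of D. *)
Definition H0 (D : lineBundle) (e : nat) : set K :=
  [set s | forall O, points O -> O (s / frame D O ^+ e)].

(** The e-th tensor power of D is very ample: some of its global sections
    s_0, ..., s_N generate it, and the morphism X -> P^N that they define is
    an isomorphism onto its image, the latter being the projective model of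
    (s_0, ..., s_N). *)
Definition very_ample (D : lineBundle) (e : nat) : Prop :=
  exists N (s : 'I_N.+1 -> K),
    [/\ forall j, H0 D e (s j),
        forall O, points O -> exists j, is_unit_in O (s j / frame D O ^+ e) &
        proj_model (kconst X) s = points].

(** The Q-line bundle L = (1 / qden) qbase. *)
Record qLineBundle := QLineBundle {
  qbase : lineBundle;
  qden : nat;
  qden_gt0 : (0 < qden)%N
}.

(** For m divisible by [qden L], mL is the line bundle (m / qden) qbase; the
    next definitions are only meaningful for such m. *)
Definition line_mult (L : qLineBundle) (m : nat) : nat := (m %/ qden L)%N.

Definition ample (L : qLineBundle) : Prop :=
  exists m, [/\ (0 < m)%N, (qden L %| m)%N & very_ample (qbase L) (line_mult L m)].

Definition sections (L : qLineBundle) (m : nat) : set K :=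
  H0 (qbase L) (line_mult L m).

(** The section ring, the direct sum of the R_m for m divisible by d, as a
    graded subring of K[T]: s in R_m is encoded as s T^m. *)
Definition section_ring (L : qLineBundle) (d : nat) : set {poly K} :=
  [set f | forall m, sections L m f`_m /\ (~~ (d %| m)%N -> f`_m = 0)].

(** The d such that R^(d) is defined. *)
Definition level (L : qLineBundle) (d : nat) : Prop :=
  (0 < d)%N /\ (qden L %| d)%N.

(** ** Berkovich analytification *)

Variable R : realType.

(** A real-valued valuation, trivial on k, on the residue field of the point
    with local ring [bring], i.e. on the function field of the closure of this
    point. It is seen as a function on [bring], with value +oo on its maximal
    ideal, and extended by -oo to rational functions not in [bring]. *)
Record berkovich := Berkovich {
  bring : set K;
  bval : K -> \bar R;
  bringP : points bring;
  bval_pinfty : forall f, bval f = +oo%E <-> max_ideal bring f;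
  bval_ninfty : forall f, bval f = -oo%E <-> ~ bring f;
  bval_const : forall a : k, a != 0 -> bval (kconst X a) = 0%E;
  bvalM : forall f g, bring f -> bring g -> bval (f * g) = (bval f + bval g)%E;
  bvalD : forall f g, bring f -> bring g ->
    (Order.min (bval f) (bval g) <= bval (f + g)%R)%E
}.

Definition is_center (v : berkovich) (O : set K) : Prop :=
  [/\ points O, forall f, O f -> (0 <= bval v f)%E &
      forall f, O f -> ((0 < bval v f)%E <-> max_ideal O f)].

(** The center of v exists and is unique since X is proper. *)
Definition berk_center (v : berkovich) : set K := get (is_center v).

(** v(s), for s a section of mL. *)
Definition sect_val (L : qLineBundle) (v : berkovich) (m : nat) (s : K) : \bar R :=
  bval v (s / frame (qbase L) (berk_center v) ^+ line_mult L m).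

Definition log_abs (L : qLineBundle) (v : berkovich) (m : nat) (s : K) :
  \bar R := (- sect_val L v m s)%E.

(** ** Norms *)

Record is_gnorm (L : qLineBundle) (d : nat) (chi : {poly K} -> \bar R) : Prop :=
  IsGnorm {
  gnorm_ninfty : forall f, section_ring L d f -> chi f <> -oo%E;
  gnorm_pinfty : forall f, section_ring L d f -> (chi f = +oo%E <-> f = 0);
  gnormZ : forall (a : k) f, a != 0 -> section_ring L d f ->
    chi (kconst X a *: f) = chi f;
  gnormD : forall f g, section_ring L d f -> section_ring L d g ->
    (Order.min (chi f) (chi g) <= chi (f + g)%R)%E;
  gnormM : forall f g, section_ring L d f -> section_ring L d g ->
    (chi f + chi g <= chi (f * g)%R)%E;
  gnorm_graded : forall f, section_ring L d f ->
    chi f = \big[Order.min/+oo%E]_(m < size f) chi (f`_m *: 'X^m);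
  gnorm_linear : exists2 C : R, 0 < C &
    forall m s, (0 < m)%N -> (d %| m)%N -> sections L m s -> s != 0 ->
      (`| chi (s *: 'X^m)%R | <= (C * m%:R)%R%:E)%E
}.

(** Elements of the direct limit N_R are represented by functions on K[T] that
    restrict to a norm on some R^(d), with arbitrary values elsewhere; equality
    in N_R is [NR_eq]. *)
Definition NR (L : qLineBundle) (chi : {poly K} -> \bar R) : Prop :=
  exists2 d, level L d & is_gnorm L d chi.

Definition NR_eq (L : qLineBundle) (chi chi' : {poly K} -> \bar R) : Prop :=
  exists2 d, level L d & forall f, section_ring L d f -> chi f = chi' f.

Definition homogenize (chi : {poly K} -> \bar R) (f : {poly K}) : \bar R :=
  limn (fun r : nat => ((r%:R^-1)%R%:E * chi (f ^+ r)%R)%E).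

(** "For m sufficiently divisible" *)
Definition divisibly : set_system nat :=
  filter_from [set d | (0 < d)%N] (fun d => [set m | (0 < m)%N /\ (d %| m)%N]).

Definition FS_term (L : qLineBundle) (chi : {poly K} -> \bar R)
    (v : berkovich) (m : nat) : \bar R :=
  ((m%:R^-1)%R%:E * ereal_sup
    ((fun s => log_abs L v m s + chi (s *: 'X^m)%R) @`
      [set s | sections L m s /\ (s != 0)%R]))%E.

(** [fine] only casts to R the limit, which is finite when L is ample and chi
    is in N_R. *)
Definition FS (L : qLineBundle) (chi : {poly K} -> \bar R) (v : berkovich) : R :=
  fine (lim (FS_term L chi v @ divisibly)).

Definition IN (L : qLineBundle) (phi : berkovich -> R) (f : {poly K}) : \bar R :=
  \big[Order.min/+oo%E]_(m < size f)
    ereal_inf (range (fun v => (sect_val L v m f`_m + (m%:R * phi v)%R%:E)%E)).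

End Variety.

(* Main.v *)
Require Import Defs.
From mathcomp Require Import all_boot all_order all_algebra.
From mathcomp Require Import all_classical all_reals all_analysis.
From mathcomp Require Import ring lra.

(** The inequality chi^hom <= IN (FS chi) is formal: a power s ^+ r of a section
    s of mL contributes log |s ^+ r| + chi (s ^+ r) to the supremum defining
    FS chi, so that v (s) + m FS chi (v) >= chi (s ^+ r) / r for all v and r
    ([homogenize_le_FS]).

    The other inequality is a form of the theorem that the spectral radius is
    the supremum of the bounded multiplicative seminorms. For a section s <> 0
    of mL with m > 0, one needs a point v of X^an such that
      v (s) + m FS chi (v) <= chi^hom (s),
    and by definition of FS it is enough that
      (chi (t) - v (t)) / m' <= (chi^hom (s) - v (s)) / m
    for all sections t of m'L. Put c = chi^hom (s). On the functions t / s ^+ n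
    on the affine variety X \ (s = 0), the values chi^hom (t) - n c define a
    submultiplicative ultrametric seminorm. A maximal such seminorm above it
    exists by Zorn's lemma, and is multiplicative ([filt_valM]): it equals its
    own homogenization, and it equals its own localization at any element with a
    finite value, since both constructions give larger seminorms. The multiplicative
    seminorm so obtained is a point v of X^an, and its value at t ^+ m / s ^+ m'
    is at least m chi (t) - m' c, which is the wanted inequality
    ([exists_valuation]).

    Two classical facts on X are used to see v as a point of X, which is given
    by coordinates x_j in |m_0 L|. First, sections of a multiple of m_0 L are
    polynomials in the x_j on each chart ([H0_chart]), because a ring is the
    intersection of its localizations ([localize_all]). Second, the x_j do not
    vanish simultaneously at v. As s multiplies the forms of large degree in
    the x_j into the forms, it is integral over the ring of forms; so if all
    x_j ^+ a / s had the value +oo then so would 1 ([coord_notin_prime]).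
    The same argument with a = 0 shows that R_0 = k, where both norms are
    trivial. The finiteness of FS chi, by which it is a function to R, rests
    on the existence of a center of v ([exists_center]), where some x_j does
    not vanish.

    Norms are handled through the sets of elements of value at least a, for
    real a. Fekete's lemma ([homogenize_cvg_sup]) identifies the limit in the
    definition of chi^hom with the corresponding homogenization of
    filtrations, which is compatible with sums by the binomial formula
    ([filt_hom_filtration]). That chi^hom is again the minimum of its values
    on homogeneous components follows by looking at the lowest terms of the
    powers of f ([filt_hom_coef]). *)

Set Implicit Arguments.
Unset Strict Implicit.
Unset Printing Implicit Defensive.

Import Order.TTheory GRing.Theory Num.Theory.
Import numFieldNormedType.Exports.

Local Open Scope classical_set_scope.
Local Open Scope ring_scope.

(** * Filtrations and their homogenization *)

Lemma exists_mul_gt (R : realType) (C e : R) : 0 < e ->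
  exists2 j, (0 < j)%N & C < j%:R * e.
Proof.
move=> e0; exists (Num.Def.archi_bound (`|C| / e)).+1 => //.
rewrite -ltr_pdivrMr//; apply: le_lt_trans (_ : `|C| / e < _).
  by rewrite ler_wpM2r ?ler_norm// invr_ge0 ltW.
apply: lt_le_trans (archi_boundP _) _; first by rewrite divr_ge0// ltW.
by rewrite ler_nat.
Qed.

Section Filtration.
Variables (R : realType) (A : comNzRingType).

(** A submultiplicative ultrametric seminorm chi on a subring of A, written
    additively, is encoded by its sets of elements with chi >= a. The subring
    is the union of these sets, so it can grow along inclusions of
    filtrations; this makes the union of a chain a filtration. The last field
    says that the seminorm is not identically +oo. *)
Record filtration (F : R -> set A) : Prop := Filtration {
  filt_anti : forall a b f, a <= b -> F b f -> F a f;
  filt0 : forall a, F a 0;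
  filtB : forall a f g, F a f -> F a g -> F a (f - g);
  filtM : forall a b f g, F a f -> F b g -> F (a + b) (f * g);
  filt1 : exists a, F a 1;
  filt_bounded : forall a, 0 < a -> ~ F a 1 }.

Definition filt_dom (F : R -> set A) : set A := [set f | exists a, F a f].

(** The elements f such that chi (f ^+ i) >= i (a - e) - O_e(1) for all
    e > 0, that is, lim chi (f ^+ i) / i >= a. *)
Definition filt_hom (F : R -> set A) (a : R) : set A :=
  [set f | forall e, 0 < e ->
    exists C, forall i : nat, F (i%:R * (a - e) - C) (f ^+ i)].

Section Theory.
Variables (F : R -> set A) (hF : filtration F).

Lemma filtN a f : F a f -> F a (- f).
Proof. by move=> Ff; rewrite -sub0r; apply: filtB => //; apply: filt0. Qed.

Lemma filtD a f g : F a f -> F a g -> F a (f + g).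
Proof. by move=> Ff Fg; rewrite -[g]opprK; apply: filtB => //; apply: filtN. Qed.

Lemma filt_sum (I : Type) (r : seq I) (P : pred I) (G : I -> A) a :
  (forall i, P i -> F a (G i)) -> F a (\sum_(i <- r | P i) G i).
Proof. by move=> FG; elim/big_ind: _ => //; [apply: filt0|apply: filtD]. Qed.

Lemma filtMn a f n : F a f -> F a (f *+ n).
Proof.
by move=> Ff; elim: n => [|n IHn]; rewrite ?mulr0n ?mulrS;
   [apply: filt0|apply: filtD].
Qed.

Lemma filt1N : exists2 C, 0 <= C & F (- C) 1.
Proof.
have [a Fa] := filt1 hF; exists `|a| => //.
by apply: filt_anti Fa => //; rewrite lerNl -normrN ler_norm.
Qed.

Lemma filtX a f n : (0 < n)%N -> F a f -> F (n%:R * a) (f ^+ n).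
Proof.
case: n => // n _ Ff; elim: n => [|n IHn]; first by rewrite mul1r expr1.
by rewrite exprS -natr1 mulrDl mul1r addrC; apply: filtM.
Qed.

Lemma filt_domX f i : filt_dom F f -> filt_dom F (f ^+ i).
Proof.
move=> [a Ff]; elim: i => [|i [b Fb]]; first by rewrite expr0; apply: filt1.
by exists (a + b); rewrite exprS; apply: filtM.
Qed.

Lemma filtX_bound a f : F a f -> exists C, forall i, F (i%:R * a - C) (f ^+ i).
Proof.
move=> Ff; have [C _ F1] := filt1N; exists C; elim=> [|i IHi].
  by rewrite mul0r sub0r expr0.
rewrite exprS (_ : _ - C = a + (i%:R * a - C)); last by rewrite -natr1; ring.
exact: filtM.
Qed.

Lemma filt_sub_hom a f : F a f -> filt_hom F a f.
Proof.
move=> Ff e e0; have [C FC] := filtX_bound Ff; exists C => i.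
by apply: filt_anti (FC i) => //; rewrite lerD2r ler_wpM2l// gerBl ltW.
Qed.

Lemma filt_hom_closed a f :
  (forall e, 0 < e -> F (a - e) f) -> filt_hom F a f.
Proof. by move=> Ff e e0; apply: filtX_bound; apply: Ff. Qed.

Lemma filt_hom1 : filt_hom F 0 1.
Proof.
have [C C0 FC] := filt1N; move=> e e0; exists C => i; rewrite expr1n.
apply: (filt_anti hF) FC; rewrite sub0r mulrN -opprD lerN2 lerDr.
by rewrite mulr_ge0// ltW.
Qed.

(** Superadditivity of chi (f ^+ i): division of i by r with remainder turns
    a lower bound at one exponent into a lower bound at all exponents. *)
Lemma filt_hom_root a f r : (0 < r)%N -> filt_dom F f ->
  F (r%:R * a) (f ^+ r) -> filt_hom F a f.
Proof.
move=> r0 domf Fr.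
have [C HC] : exists C, forall i, (i < r)%N -> F (i%:R * a - C) (f ^+ i).
  elim: {1}r => [|n [C IH]]; first by exists 0.
  have [b Fb] := filt_domX n domf.
  exists (Num.max C (n%:R * a - b)) => i; rewrite ltnS leq_eqVlt => /predU1P[->|].
    by apply: filt_anti Fb => //; rewrite lerBlDr -lerBlDl le_max lexx orbT.
  by move=> /IH; apply: filt_anti => //; rewrite lerD2l lerN2 le_max lexx.
have {}HC i : F (i%:R * a - C) (f ^+ i).
  elim/ltn_ind: i => i IHi; have [/HC//|ri] := ltnP i r.
  rewrite -(subnKC ri) exprD natrD mulrDl -addrA; apply: filtM => //.
  by apply: IHi; rewrite ltn_subrL r0 (leq_trans r0 ri).
move=> e e0; exists C => i.
by apply: filt_anti (HC i) => //; rewrite lerD2r ler_wpM2l// gerBl ltW.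
Qed.

Lemma filt_hom_closed_hom a f :
  (forall e, 0 < e -> filt_hom F (a - e) f) -> filt_hom F a f.
Proof.
move=> Ha e e0; have e20 : 0 < e / 2 by rewrite divr_gt0.
by have := Ha _ e20 _ e20; rewrite -addrA -opprD -splitr.
Qed.

(** The homogenization is power-multiplicative; this is the inequality
    r chi^hom (f) >= chi^hom (f ^+ r). *)
Lemma filt_hom_hom_root a f r : (0 < r)%N -> filt_dom F f ->
  filt_hom F (r%:R * a) (f ^+ r) -> filt_hom F a f.
Proof.
move=> r0 domf Hr; apply: filt_hom_closed_hom => e e0.
have rR0 : 0 < r%:R :> R by rewrite ltr0n.
have er0 : 0 < e * r%:R / 2 by rewrite divr_gt0// mulr_gt0.
have [C HC] := Hr _ er0.
have [j j0 jC] := exists_mul_gt C er0.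
have jr0 : (0 < r * j)%N by rewrite muln_gt0 r0.
apply: (filt_hom_root jr0 domf).
rewrite exprM; apply: (filt_anti hF) (HC j).
have -> : (r * j)%:R * (a - e) = j%:R * (r%:R * a - e * r%:R / 2) - j%:R * (e * r%:R / 2).
  by rewrite natrM; field.
by rewrite lerD2l lerN2 ltW.
Qed.

Lemma filt_hom_bounded a : 0 < a -> ~ filt_hom F a 1.
Proof.
move=> a0 /(_ (a / 2)); rewrite divr_gt0// => /(_ erefl)[C HC].
have [i _ Ci] := exists_mul_gt C (divr_gt0 a0 (ltr0n _ 2)).
have := HC i; rewrite expr1n; apply: filt_bounded => //; rewrite subr_gt0.
by rewrite (_ : a - a / 2 = a / 2)//; field.
Qed.

(** Stability under subtraction is the binomial formula: each term
    f ^+ (i - j) * g ^+ j of (f - g) ^+ i satisfies the wanted lower bound. *)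
Lemma filt_hom_filtration : filtration (filt_hom F).
Proof.
split.
- move=> a b f ab Ff e e0; have [C HC] := Ff _ e0; exists C => i.
  by apply: filt_anti (HC i) => //; rewrite lerD2r ler_wpM2l// lerD2r.
- by move=> a; apply: filt_sub_hom; apply: filt0.
- move=> a f g Ff Fg e e0; have [C HC] := Ff _ e0; have [D HD] := Fg _ e0.
  exists (C + D) => i; rewrite exprBn; apply: filt_sum => j _; apply: filtMn.
  have ji : (j <= i)%N by rewrite -ltnS.
  have -> : i%:R * (a - e) - (C + D) =
      ((i - j)%:R * (a - e) - C) + (j%:R * (a - e) - D).
    by rewrite natrB//; ring.
  have := filtM hF (HC (i - j)%N) (HD j).
  rewrite -mulrA -signr_odd; case: (odd j) => //=; rewrite ?mul1r// mulN1r.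
  exact: filtN.
- move=> a b f g Ff Fg e e0.
  have [C HC] := Ff _ (divr_gt0 e0 (ltr0n _ 2)).
  have [D HD] := Fg _ (divr_gt0 e0 (ltr0n _ 2)).
  exists (C + D) => i; rewrite exprMn.
  have -> : i%:R * (a + b - e) - (C + D) =
      (i%:R * (a - e / 2) - C) + (i%:R * (b - e / 2) - D).
    by field.
  exact: filtM.
- by have [a Fa] := filt1 hF; exists a; apply: filt_sub_hom.
- exact: filt_hom_bounded.
Qed.

End Theory.

Definition filt_max (F : R -> set A) : Prop :=
  filtration F /\ forall G, filtration G ->
    (forall a, F a `<=` G a) -> forall a, G a `<=` F a.

(** Zorn's lemma applies to the filtrations above F, seen as subsets of R * A;
    the empty set is added for the empty chain. *)
Lemma exists_filt_max (F : R -> set A) : filtration F ->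
  exists2 G, filt_max G & forall a, F a `<=` G a.
Proof.
move=> hF.
pose rel_of (X : set (R * A)) (a : R) : set A := [set f | X (a, f)].
pose P (X : set (R * A)) := X = set0 \/
  (filtration (rel_of X) /\ forall a, F a `<=` rel_of X a).
have [|X [PX Xmax]] := @Zorn_bigcup _ P.
  move=> Y YP Ytot.
  have [Y0|[X0 [YX0 [X0' sX0]]]] :
      (forall X, Y X -> X = set0) \/ exists X, Y X /\ filtration (rel_of X) /\
        forall a, F a `<=` rel_of X a.
    have [[X YX]|/forallNP noX] := pselect (exists X, Y X /\
        (filtration (rel_of X) /\ forall a, F a `<=` rel_of X a)).
      by right; exists X.
    by left => X YX; case: (YP _ YX) => // ?; case: (noX X).
  - left; rewrite -subset0 => p [X YX] Xp; by rewrite -(Y0 _ YX).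
  have filtY X p : Y X -> X p -> filtration (rel_of X).
    by move=> YX Xp; case: (YP _ YX) => [X00|[]//]; rewrite X00 in Xp.
  right; split; last by move=> a f Ff; exists X0 => //; apply: sX0.
  have dir p q X X' : Y X -> Y X' -> X p -> X' q ->
      exists2 Z, Y Z & Z p /\ Z q.
    move=> YX YX' Xp Xq; have [XX'|XX'] := Ytot _ _ YX YX'.
      by exists X' => //; split => //; apply: XX'.
    by exists X => //; split => //; apply: XX'.
  split.
  - move=> a b f ab [X YX Xf]; exists X => //.
    exact: (filt_anti (filtY _ _ YX Xf) ab Xf).
  - by move=> a; exists X0 => //; apply: (filt0 X0').
  - move=> a f g [X YX Xf] [X' YX' Xg].
    have [Z YZ [Zf Zg]] := dir _ _ _ _ YX YX' Xf Xg; exists Z => //.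
    exact: (filtB (filtY _ _ YZ Zf) Zf Zg).
  - move=> a b f g [X YX Xf] [X' YX' Xg].
    have [Z YZ [Zf Zg]] := dir _ _ _ _ YX YX' Xf Xg; exists Z => //.
    exact: (filtM (filtY _ _ YZ Zf) Zf Zg).
  - by have [a X1] := filt1 X0'; exists a; exists X0.
  - by move=> a a0 [X YX X1]; apply: (filt_bounded (filtY _ _ YX X1) a0 X1).
have le_F : P [set p | F p.1 p.2] by right; split => // a f.
case: PX => [X0|[filtX sX]].
  have [a F1] := filt1 hF.
  exfalso; apply: (Xmax _ _ le_F); rewrite X0; split => //.
  by move/(_ (a, 1) F1).
exists (rel_of X) => //; split => // G filtG sG a f Gf.
have [//|nX] := pselect (X (a, f)).
exfalso; apply: (Xmax [set p | G p.1 p.2]).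
  split; first by move=> [b g] /sG.
  by move/(_ (a, f) Gf).
by right; split => // b g /sX /sG.
Qed.

End Filtration.

(** * Maximal filtrations *)

Lemma lee_EFin_lower (R : realType) (x y : \bar R) :
  (forall a : R, a%:E <= x -> a%:E <= y)%E -> (x <= y)%E.
Proof.
case: x => [a| |] xy; [exact: xy| |exact: leNye].
by rewrite leye_eq; apply/eqP/eqyP => a _; apply: xy; rewrite leey.
Qed.

Section MaximalFiltration.
Variables (R : realType) (A : comNzRingType) (F : R -> set A).

Definition filt_val (f : A) : \bar R := ereal_sup (EFin @` [set a | F a f]).

Hypothesis maxF : filt_max F.
Let filtF : filtration F := maxF.1.

Lemma filt_max_hom a : filt_hom F a `<=` F a.
Proof.
apply: (maxF.2 _ (filt_hom_filtration filtF)) => b f.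
exact: (filt_sub_hom filtF).
Qed.

Lemma filt_valP a f : F a f <-> (a%:E <= filt_val f)%E.
Proof.
split=> [Ff|le_a]; first by apply: ereal_sup_ubound; exists a.
apply: filt_max_hom; apply: (filt_hom_closed filtF) => e e0.
have /ereal_sup_gt[_ [b Fb <-]] : ((a - e)%:E < filt_val f)%E.
  by apply: lt_le_trans le_a; rewrite lte_fin gtrBl.
by rewrite lte_fin => /ltW ab; apply: (filt_anti filtF) Fb.
Qed.

Lemma filt_val_dom f : filt_dom F f <-> filt_val f <> -oo%E.
Proof.
split=> [[a /filt_valP]|]; first by move=> + vf; rewrite vf.
case vf : (filt_val f) => [a| |] // _.
- by exists a; apply/filt_valP; rewrite vf.
- by exists 0; apply/filt_valP; rewrite vf leey.
Qed.

Lemma filt_val0 : filt_val 0 = +oo%E.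
Proof. by apply/eqyP => a _; apply/filt_valP; apply: filt0. Qed.

Lemma filt_val1 : filt_val 1 = 0%E.
Proof.
apply/eqP; rewrite eq_le; apply/andP; split.
  rewrite leNgt; apply/negP => /ereal_sup_gt[_ [a Fa <-]].
  by rewrite lte_fin => /(filt_bounded filtF); apply.
by apply/filt_valP/filt_max_hom/(filt_hom1 filtF).
Qed.

(** The localization of F at g extends it to the elements f / g ^+ n, with
    value val (f) - n c. It is a filtration because powers of g cannot exceed
    the bound c, so by maximality it brings nothing new. *)
Lemma filt_max_div c g a n f : filt_val g = c%:E ->
  F (a + n%:R * c) (f * g ^+ n) -> F a f.
Proof.
move=> vg.
have Fg : F c g by apply/filt_valP; rewrite vg.
pose G a := [set f | exists n, F (a + n%:R * c) (f * g ^+ n)].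
have raise b h m p : (m <= p)%N -> F (b + m%:R * c) (h * g ^+ m) ->
    F (b + p%:R * c) (h * g ^+ p).
  move=> /subnKC <-; elim: (p - m)%N => [|q IHq]; first by rewrite addn0.
  move=> /IHq Fq; rewrite addnS exprSr mulrA -natr1 mulrDl mul1r addrA.
  exact: (filtM filtF).
have filtG : filtration G.
  split.
  - move=> b b' h bb' [m Fm]; exists m.
    by apply: (filt_anti filtF) Fm; rewrite lerD2r.
  - by move=> b; exists 0%N; rewrite !mul0r; apply: (filt0 filtF).
  - move=> b h h' [m Fm] [m' Fm']; exists (maxn m m').
    rewrite mulrBl; apply: (filtB filtF).
      by apply: raise Fm; rewrite leq_maxl.
    by apply: raise Fm'; rewrite leq_maxr.
  - move=> b b' h h' [m Fm] [m' Fm']; exists (m + m')%N.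
    have := filtM filtF Fm Fm'; rewrite exprD mulrACA.
    by congr F; rewrite natrD; ring.
  - by have [b Fb] := filt1 filtF; exists b, 0%N; rewrite mul0r addr0 mulr1.
  - move=> b b0 [[|m]]; rewrite mul1r.
      by rewrite mul0r addr0 expr0; apply: (filt_bounded filtF).
    have -> : b + m.+1%:R * c = m.+1%:R * (c + b / m.+1%:R) by field.
    move/(filt_hom_root filtF (ltn0Sn m)) => Fm.
    have /filt_valP : F (c + b / m.+1%:R) g.
      by apply: filt_max_hom; apply: Fm; exists c.
    by rewrite vg lee_fin gerDl leNgt divr_gt0.
move=> Ffg; apply: (maxF.2 _ filtG); last by exists n.
by move=> b h Fh; exists 0%N; rewrite mul0r addr0 mulr1.
Qed.

(** Division by g, allowed by [filt_max_div], turns the inequality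
    val (f g) >= val (f) + val (g) into an equality. *)
Lemma filt_valM f g : filt_dom F f -> filt_dom F g ->
  filt_val (f * g) = (filt_val f + filt_val g)%E.
Proof.
move=> domf domg.
wlog [c vg] : f g domf domg / exists c, filt_val g = c%:E.
  move=> wl; case vg : (filt_val g) => [c| |].
  - by rewrite (wl f g) ?vg//; exists c.
  - case vf : (filt_val f) => [c| |].
    + by rewrite mulrC (wl g f) ?vg ?vf//; exists c.
    + apply/eqyP => a _; apply/filt_valP; rewrite -[a](subrK 0).
      by apply: (filtM filtF); apply/filt_valP; rewrite ?vf ?vg leey.
    + by case/filt_val_dom: domf.
  - by case/filt_val_dom: domg.
have Fg : F c g by apply/filt_valP; rewrite vg.
have key a : (a%:E <= filt_val (f * g) <-> a%:E <= filt_val f + filt_val g)%E.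
  rewrite vg -leeBlDr// -EFinB; split=> [/filt_valP Fa|/filt_valP Fa].
    apply/filt_valP/(filt_max_div (n := 1%N) vg).
    by rewrite mul1r subrK expr1.
  by apply/filt_valP; rewrite -[a](subrK c); apply: (filtM filtF).
by apply/le_anti/andP; split; apply: lee_EFin_lower => a /key.
Qed.

Lemma filt_valD f g :
  (Order.min (filt_val f) (filt_val g) <= filt_val (f + g))%E.
Proof.
case m : (Order.min _ _) => [a| |]; last exact: leNye.
- by apply/filt_valP/(filtD filtF); apply/filt_valP; rewrite -m ge_min lexx ?orbT.
- have [vf vg] : filt_val f = +oo%E /\ filt_val g = +oo%E.
    by split; apply/eqP; rewrite -leye_eq -m ge_min lexx ?orbT.
  rewrite leye_eq; apply/eqP/eqyP => a _.
  by apply/filt_valP/(filtD filtF); apply/filt_valP; rewrite ?vf ?vg leey.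
Qed.

Lemma filt_dom_subring :
  [/\ filt_dom F 1,
      forall f g, filt_dom F f -> filt_dom F g -> filt_dom F (f - g) &
      forall f g, filt_dom F f -> filt_dom F g -> filt_dom F (f * g)].
Proof.
split; first exact: (filt1 filtF).
- move=> f g [a Fa] [b Fb]; exists (Num.min a b); apply: (filtB filtF).
    by apply: (filt_anti filtF) Fa; rewrite ge_min lexx.
  by apply: (filt_anti filtF) Fb; rewrite ge_min lexx orbT.
- by move=> f g [a Fa] [b Fb]; exists (a + b); apply: (filtM filtF).
Qed.

End MaximalFiltration.

(** The subring of elements of value > -oo is local: elements of finite value
    are invertible, again by localization. *)
Lemma filt_dom_inv (R : realType) (K : fieldType) (F : R -> set K) g :
  filt_max F -> filt_dom F g -> filt_val F g <> +oo%E ->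
  g != 0 /\ filt_dom F g^-1.
Proof.
move=> maxF /(filt_val_dom maxF); case vg : (filt_val F g) => [c| |]// _ _.
have g0 : g != 0 by apply/eqP => g0; move: vg; rewrite g0 (filt_val0 maxF).
split => //; exists (- c); apply: (filt_max_div (n := 1%N) maxF vg).
by rewrite mul1r addNr expr1 mulVf//; apply/(filt_valP maxF); rewrite filt_val1.
Qed.

(** * Subalgebras, prime ideals and localizations *)

Section Localization.
Variables (k K : fieldType) (iota : {rmorphism k -> K}) (A : set K).
Hypothesis algA : is_subalg iota A.

Lemma subalg1 : A 1.
Proof. by have [/(_ 1)] := algA; rewrite rmorph1. Qed.

Lemma subalg0 : A 0.
Proof. by have [/(_ 0)] := algA; rewrite rmorph0. Qed.

Lemma subalgB f g : A f -> A g -> A (f - g).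
Proof. by case: algA => _ + _; apply. Qed.

Lemma subalgM f g : A f -> A g -> A (f * g).
Proof. by case: algA => _ _; apply. Qed.

Lemma subalgN f : A f -> A (- f).
Proof. by rewrite -sub0r; apply: subalgB; apply: subalg0. Qed.

Lemma subalgD f g : A f -> A g -> A (f + g).
Proof. by move=> Af Ag; rewrite -[g]opprK; apply: subalgB => //; apply: subalgN. Qed.

Lemma subalgX f n : A f -> A (f ^+ n).
Proof.
by move=> Af; elim: n => [|n IHn]; rewrite ?expr0 ?exprS;
   [apply: subalg1|apply: subalgM].
Qed.

Section Prime.
Variables (p : set K).
Hypothesis primep : is_prime_ideal A p.

Lemma prime_sub : p `<=` A. Proof. by case: primep. Qed.
Lemma prime0 : p 0. Proof. by case: primep => _ []. Qed.
Lemma prime1 : ~ p 1. Proof. by case: primep => _ []. Qed.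

Lemma primeD f g : p f -> p g -> p (f + g).
Proof. by case: primep => _ _ + _ _; apply. Qed.

Lemma primeMl a f : A a -> p f -> p (a * f).
Proof. by case: primep => _ _ _ + _; apply. Qed.

Lemma primeN f : p f -> p (- f).
Proof. by rewrite -mulN1r; apply: primeMl; apply/subalgN/subalg1. Qed.

Lemma prime_notM f g : A f -> A g -> ~ p f -> ~ p g -> ~ p (f * g).
Proof. by case: primep => _ _ _ _ H Af Ag nf ng /(H _ _ Af Ag) []. Qed.

Lemma prime_neq0 b : ~ p b -> b != 0.
Proof. by move=> pb; apply/eqP => b0; apply: pb; rewrite b0; apply: prime0. Qed.

Lemma sub_localize : A `<=` localize A p.
Proof.
move=> a Aa; exists a, 1; split; [by []|exact: subalg1|exact: prime1|].
by rewrite divr1.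
Qed.

Lemma localize_subalg : is_subalg iota (localize A p).
Proof.
split.
- by move=> a; apply: sub_localize; case: algA.
- move=> _ _ [a [b [Aa Ab pb ->]]] [c [d [Ac Ad pd ->]]].
  exists (a * d - c * b), (b * d); split.
  - by apply: subalgB; apply: subalgM.
  - exact: subalgM.
  - exact: prime_notM.
  - have := prime_neq0 pb; have := prime_neq0 pd => d0 b0.
    by field; rewrite b0 d0.
- move=> _ _ [a [b [Aa Ab pb ->]]] [c [d [Ac Ad pd ->]]].
  exists (a * c), (b * d); split; [exact: subalgM|exact: subalgM|exact: prime_notM|].
  by rewrite mulf_div.
Qed.

Lemma localize_max_ideal a b : A a -> A b -> ~ p b ->
  max_ideal (localize A p) (a / b) <-> p a.
Proof.
move=> Aa Ab pb; have b0 := prime_neq0 pb.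
split=> [[_ nunit]|pa].
  have [//|npa] := pselect (p a); case: nunit.
  have a0 := prime_neq0 npa; split.
  - by rewrite mulf_neq0// invr_neq0.
  - by exists a, b.
  - by exists b, a; split; rewrite ?invf_div.
split; first by exists a, b.
case=> ab0 _ [c [d [Ac Ad pd e]]].
have a0 : a != 0 by apply: contraNneq ab0 => ->; rewrite mul0r.
have e' : b * d = c * a.
  have d0 := prime_neq0 pd.
  by move/eqP: e; rewrite invf_div eqr_div// => /eqP.
by apply: (prime_notM Ab Ad pb pd); rewrite e'; apply: primeMl.
Qed.

End Prime.

Definition filt_kernel (R : realType) (F : R -> set K) : set K :=
  [set f | A f /\ filt_val F f = +oo%E].

Section Kernel.
Variables (R : realType) (F : R -> set K).
Hypotheses (maxF : filt_max F) (AF : A `<=` filt_dom F).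

Lemma filt_kernel_prime : is_prime_ideal A (filt_kernel F).
Proof.
split.
- by move=> f [].
- split; first by split; [exact: subalg0|exact: filt_val0].
  by case=> _; rewrite filt_val1.
- move=> f g [Af vf] [Ag vg]; split; first exact: subalgD.
  apply/eqP; rewrite -leye_eq; apply: le_trans (filt_valD maxF f g).
  by rewrite vf vg minxx.
- move=> a f Aa [Af vf]; split; first exact: subalgM.
  rewrite filt_valM// ?vf; [|exact: AF|exact: AF].
  by have /(filt_val_dom maxF) := AF Aa; case: (filt_val F a).
- move=> f g Af Ag [_]; rewrite filt_valM//; [|exact: AF|exact: AF].
  case vf : (filt_val F f) => [a| |]; last 2 first.
  - by left.
  - by have /(filt_val_dom maxF) := AF Af.
  case vg : (filt_val F g) => [b| |] // _; by right.
Qed.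

Lemma localize_filt_dom f : localize A (filt_kernel F) f -> filt_dom F f.
Proof.
move=> [a [b [Aa Ab kb ->]]].
have [_ _ domM] := filt_dom_subring maxF.
apply: domM; first exact: AF.
have [] := @filt_dom_inv _ _ _ b maxF (AF Ab) => //.
by move=> vb; apply: kb.
Qed.

Lemma localize_filt_max f : localize A (filt_kernel F) f ->
  filt_val F f = +oo%E <-> max_ideal (localize A (filt_kernel F)) f.
Proof.
move=> [a [b [Aa Ab kb ->]]].
rewrite (localize_max_ideal filt_kernel_prime)//.
have vb : filt_val F b <> +oo%E by move=> vb; apply: kb.
have [b0 domb] := filt_dom_inv maxF (AF Ab) vb.
rewrite filt_valM//; last exact: AF.
have : (filt_val F b + filt_val F b^-1 = 0)%E.
  by rewrite -filt_valM ?mulfV ?filt_val1//; apply: AF.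
have /(filt_val_dom maxF) := domb; have /(filt_val_dom maxF) := AF Aa.
have /(filt_val_dom maxF) := AF Ab.
case vb': (filt_val F b) => [r| |]//; case: (filt_val F b^-1) => [r'| |]//.
move=> _ va _ _; split.
  by case va' : (filt_val F a) va => //.
by case=> _ ->.
Qed.

End Kernel.

(** Krull's theorem: the kernel of a maximal filtration contains I as soon as
    the elements of I have arbitrarily large values, which the filtration F
    below enforces. *)
Lemma exists_prime_ideal (R : realType) (I : set K) :
  I `<=` A -> I 0 -> ~ I 1 -> (forall f g, I f -> I g -> I (f - g)) ->
  (forall a f, A a -> I f -> I (a * f)) ->
  exists2 p, is_prime_ideal A p & I `<=` p.
Proof.
move=> IA I0 I1 IB IM.
pose F (a : R) : set K := if a <= 0 then A else I.
have filtF : filtration F.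
  split.
  - move=> a b f ab; rewrite /F; case: ifPn => b0; case: ifPn => a0 //.
      by move: a0; rewrite (le_trans ab b0).
    exact: IA.
  - by move=> a; rewrite /F; case: ifP => _ //; apply: subalg0.
  - by move=> a f g; rewrite /F; case: ifP => _; [apply: subalgB|apply: IB].
  - move=> a b f g; rewrite /F.
    have AF' (c : R) h : (if c <= 0 then A else I) h -> A h by case: ifP => // _ /IA.
    move=> Ff Fg; have [Af Ag] := (AF' _ f Ff, AF' _ g Fg).
    case: ifPn => ab; first exact: subalgM.
    case: ifPn Ff => a0 Ff; case: ifPn Fg => b0 Fg.
    + by move: ab; rewrite -ltNge; lra.
    + exact: IM.
    + by rewrite mulrC; apply: IM.
    + exact: IM.
  - by exists 0; rewrite /F lexx; apply: subalg1.
  - by move=> a; rewrite /F ltNge; case: ifP.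
have [G maxG FG] := exists_filt_max filtF.
exists (filt_kernel G).
  by apply: filt_kernel_prime => // a Aa; exists 0; apply: FG; rewrite /F lexx.
move=> f If; split; first exact: IA.
apply/eqyP => a _; apply/(filt_valP maxG)/FG; rewrite /F; case: ifP => // _.
exact: IA.
Qed.

(** The denominators of y form an ideal that lies in no prime ideal. *)
Lemma localize_all (R : realType) y :
  (forall p, is_prime_ideal A p -> localize A p y) -> A y.
Proof.
move=> Hy; pose I := [set b | A b /\ A (b * y)].
have [[]|nI1] := pselect (I 1); first by rewrite mul1r.
have [||||p primep Ip] := @exists_prime_ideal R I _ _ nI1.
- by move=> b [].
- by split; rewrite ?mul0r; apply: subalg0.
- move=> f g [Af Afy] [Ag Agy]; split; first exact: subalgB.
  by rewrite mulrBl; apply: subalgB.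
- move=> a f Aa [Af Afy]; split; first exact: subalgM.
  by rewrite -mulrA; apply: subalgM.
have [a [b [Aa Ab pb ey]]] := Hy _ primep.
have b0 := prime_neq0 primep pb.
by case: pb; apply: Ip; split => //; rewrite ey mulrC divfK.
Qed.

End Localization.

(** * Homogeneous polynomials in the coordinates *)

Section Graded.
Variables (k K : fieldType) (iota : {rmorphism k -> K}) (n : nat).
Variables (x : 'I_n.+1 -> K).

(** The values at x of the homogeneous polynomials of degree M over k. *)
Fixpoint forms (M : nat) : set K :=
  if M is M'.+1 then
    [set f | exists2 p : 'I_n.+1 -> K,
               forall j, forms M' (p j) & f = \sum_j x j * p j]
  else range iota.

Lemma forms0 M : forms M 0.
Proof.
elim: M => [|M IHM] /=; first by exists 0 => //; rewrite rmorph0.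
by exists (fun=> 0) => //; rewrite big1// => j _; rewrite mulr0.
Qed.

Lemma formsD M f g : forms M f -> forms M g -> forms M (f + g).
Proof.
elim: M f g => [|M IHM] f g /=.
  by move=> [a _ <-] [b _ <-]; exists (a + b) => //; rewrite rmorphD.
move=> [p Sp ->] [q Sq ->]; exists (fun j => p j + q j) => [j|]; first exact: IHM.
by rewrite -big_split; apply: eq_bigr => j _; rewrite mulrDr.
Qed.

Lemma forms_sum M (I : Type) (r : seq I) (P : pred I) (G : I -> K) :
  (forall i, P i -> forms M (G i)) -> forms M (\sum_(i <- r | P i) G i).
Proof. by move=> SG; elim/big_ind: _ => //; [apply: forms0|apply: formsD]. Qed.

Lemma formsZ M c f : forms M f -> forms M (iota c * f).
Proof.
elim: M f => [|M IHM] f /=; first by move=> [a _ <-]; exists (c * a); rewrite ?rmorphM.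
move=> [p Sp ->]; exists (fun j => iota c * p j) => [j|]; first exact: IHM.
by rewrite mulr_sumr; apply: eq_bigr => j _; rewrite mulrCA.
Qed.

Lemma forms_coord M j f : forms M f -> forms M.+1 (x j * f).
Proof.
move=> Sf; exists (fun i => if i == j then f else 0) => [i|].
  by case: ifP => // _; apply: forms0.
rewrite (bigD1 j)//= eqxx big1 ?addr0// => i /negPf ->; exact: mulr0.
Qed.

Lemma formsM M N f g : forms M f -> forms N g -> forms (M + N) (f * g).
Proof.
elim: M f => [|M IHM] f.
  by move=> [a _ <-] Sg; rewrite add0n; apply: formsZ.
move=> [p Sp ->] Sg; rewrite mulr_suml addSn; apply: forms_sum => j _.
rewrite -mulrA; apply: forms_coord; exact: IHM (Sp j) Sg.
Qed.

Lemma forms_coordX M j f m : forms M f -> forms (m + M) (x j ^+ m * f).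
Proof.
move=> Sf; elim: m => [|m IHm]; first by rewrite expr0 mul1r.
by rewrite exprS -mulrA addSn; apply: forms_coord.
Qed.

Lemma forms1 : forms 0 1.
Proof. by exists 1 => //; rewrite rmorph1. Qed.

Lemma forms_monomial (l : seq 'I_n.+1) : forms (size l) (\prod_(j <- l) x j).
Proof.
elim: l => [|j l IHl]; first by rewrite big_nil; apply: forms1.
by rewrite big_cons; apply: forms_coord.
Qed.

Lemma forms_ind M (Q : K -> Prop) : Q 0 ->
  (forall f g, Q f -> Q g -> Q (f + g)) ->
  (forall c l, size l = M -> Q (iota c * \prod_(j <- l) x j)) ->
  forall f, forms M f -> Q f.
Proof.
elim: M Q => [|M IHM] Q Q0 QD Qm f.
  by move=> [c _ <-]; have := Qm c [::] erefl; rewrite big_nil mulr1.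
move=> [p Sp ->]; elim/big_ind: _ => // j _.
apply: (IHM (fun y => Q (x j * y))) (Sp j); first by rewrite mulr0.
- by move=> g h Qg Qh; rewrite mulrDr; apply: QD.
- move=> c l sl; rewrite mulrCA; have := Qm c (j :: l).
  by rewrite big_cons; apply; rewrite /= sl.
Qed.

(** The finitely many generators do not depend on a: multiplication by a
    section is then given by a finite matrix of forms. *)
Lemma forms_generators M : exists q (e : 'I_q -> K),
  (forall i, forms M (e i)) /\
  forall a f, forms (M + a) f ->
    exists2 c : 'I_q -> K, forall i, forms a (c i) & f = \sum_i c i * e i.
Proof.
suff [I [e [Se gen]]] : exists (I : finType) (e : I -> K),
    (forall i, forms M (e i)) /\ forall a f, forms (M + a) f ->
    exists2 c : I -> K, forall i, forms a (c i) & f = \sum_i c i * e i.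
  exists #|I|, (e \o enum_val); split=> [i|a f /gen[c Sc ->]]; first exact: Se.
  by exists (c \o enum_val) => [i|]; [exact: Sc|rewrite big_enum_val].
elim: M => [|M [I [e [Se gen]]]].
  exists unit, (fun=> 1); split=> [_|a f Sf]; first exact: forms1.
  by exists (fun=> f) => //; rewrite (big_pred1 tt) ?mulr1// => -[].
exists ('I_n.+1 * I)%type, (fun u => x u.1 * e u.2); split.
  by move=> u; apply: forms_coord.
move=> a f; rewrite addSn => -[p Sp ->].
have /choice[c Hc] j : exists c : I -> K,
    (forall i, forms a (c i)) /\ p j = \sum_i c i * e i.
  by have [c] := gen _ _ (Sp j); exists c.
exists (fun u => c u.1 u.2) => [u|]; first by case: (Hc u.1).
rewrite -(pair_bigA _ (fun j i => c j i * (x j * e i)))/=.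
apply: eq_bigr => j _; have [_ ->] := Hc j; rewrite mulr_sumr.
by apply: eq_bigr => i _; rewrite mulrCA.
Qed.

Lemma chart_subalg i : is_subalg iota (chart iota x i).
Proof.
split.
- by move=> a B [[]].
- by move=> f g Cf Cg B HB; case: (HB) => -[_ + _ _]; apply; [apply: Cf|apply: Cg].
- by move=> f g Cf Cg B HB; case: (HB) => -[_ _ + _]; apply; [apply: Cf|apply: Cg].
Qed.

Lemma chart_coord i j : chart iota x i (x j / x i).
Proof. by move=> B [_]; apply; exists j. Qed.

Lemma chart_forms i y : x i != 0 -> chart iota x i y ->
  exists m, forall m', (m <= m')%N -> forms m' (x i ^+ m' * y).
Proof.
move=> xi0; have raise m f : forms m (x i ^+ m * f) ->
    exists m, forall m', (m <= m')%N -> forms m' (x i ^+ m' * f).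
  move=> Sf; exists m => m' mm'; rewrite -{1 2}(subnK mm') exprD -mulrA.
  exact: forms_coordX.
suff : chart iota x i `<=`
    [set f | exists m, forall m', (m <= m')%N -> forms m' (x i ^+ m' * f)].
  by apply.
apply: smallest_sub; first split.
- by move=> a; apply: (raise 0%N); exists a => //; rewrite mul1r.
- move=> f g [m Sf] [m' Sg]; apply: (raise (m + m')%N).
  rewrite mulrBr; apply: formsD; first by apply: Sf; rewrite leq_addr.
  rewrite -mulN1r -(rmorphN1 iota); apply/formsZ/Sg; exact: leq_addl.
- move=> f g [m Sf] [m' Sg]; apply: (raise (m + m')%N).
  by rewrite exprD mulrACA; apply: formsM; [apply: Sf|apply: Sg].
- move=> _ [j _ <-]; apply: (raise 1%N); rewrite expr1 mulrC divfK//.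
  by rewrite -[x j]mulr1; apply: forms_coord; apply: forms1.
Qed.

Lemma pigeonhole_seq m (l : seq 'I_n.+1) : (n.+1 * m <= size l)%N ->
  exists j, (m <= count_mem j l)%N.
Proof.
case: m => [_|m sl]; first by exists ord0.
apply/existsP; rewrite -[X in is_true X]negbK negb_exists; apply/negP => /forallP H.
suff : (size l <= n.+1 * m)%N.
  by rewrite leqNgt => /negP; apply; apply: leq_trans sl; rewrite ltn_pmul2l.
have -> : size l = (\sum_(j < n.+1) count_mem j l)%N.
  elim: {sl H} l => [|i l IHl] /=; first by rewrite big1.
  rewrite big_split/= -IHl (bigD1 i)//= eqxx big1 ?addn0// => j.
  by rewrite eq_sym => /negPf ->.
rewrite -[X in (_ <= X * _)%N]card_ord -sum_nat_const; apply: leq_sum => j _.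
by rewrite -ltnS ltnNge; apply: H.
Qed.

(** An element f which is regular on all charts, as a section of O(a), maps
    forms of large degree to forms: a monomial of large degree is divisible by
    a large power of one of the coordinates. *)
Lemma forms_section a f :
  (forall j, x j != 0 -> chart iota x j (f / x j ^+ a)) ->
  exists M, forall g, forms M g -> forms (M + a) (f * g).
Proof.
move=> Hf.
(* One exponent for all coordinates, the zero ones included. *)
have [m [m0 Hm]] : exists m, (0 < m)%N /\
    forall j, forms (m + a) (x j ^+ m * f).
  have /choice[m Hm] j : exists m, forall m', (m <= m')%N ->
      (0 < m')%N -> forms (m' + a) (x j ^+ m' * f).
    have [xj0|xj0] := eqVneq (x j) 0.
      by exists 0%N => m' _ m'0; rewrite xj0 expr0n gtn_eqF// mul0r; apply: forms0.
    have [m Hm] := chart_forms xj0 (Hf _ xj0).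
    exists m => m' mm' _; have := Hm (m' + a)%N (leq_trans mm' (leq_addr _ _)).
    by rewrite exprD mulrACA mulfV ?expf_neq0// mulr1.
  exists (\max_j m j).+1; split => // j; apply: Hm => //.
  exact: leqW (leq_bigmax _).
exists (n.+1 * m)%N; apply: forms_ind.
- by rewrite mulr0; apply: forms0.
- by move=> g h Sg Sh; rewrite mulrDr; apply: formsD.
- move=> c l sl; rewrite mulrCA; apply: formsZ.
  have [j mj] := pigeonhole_seq (eq_leq (esym sl)).
  have -> : \prod_(i <- l) x i =
      x j ^+ m * (x j ^+ (count_mem j l - m) * \prod_(i <- l | i != j) x i).
    rewrite (bigID (fun i => i == j))/= mulrA -exprD subnKC//; congr (_ * _).
    rewrite (eq_bigr (fun=> x j)); last by move=> i /eqP ->.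
    by rewrite big_const_seq -Monoid.iteropE.
  rewrite mulrA [f * _]mulrC.
  have := formsM (Hm j) (forms_coordX j (count_mem j l - m)
            (forms_monomial [seq i <- l | i != j])).
  rewrite big_filter size_filter; congr forms; last by ring.
  have := count_predC (pred1 j) l; rewrite -sl.
  rewrite (_ : count (predC _) l = count (fun i => i != j) l)//.
  by move=> <-; rewrite -addnA addnC -addnA addnAC subnK// addnC.
Qed.

Hypothesis x_neq0 : exists j, x j != 0.

(** By [forms_section], multiplication by f expresses the generators of the
    forms of degree M in terms of themselves, with forms of degree a as
    coefficients; f is then an eigenvalue of the matrix of coefficients. *)
Lemma forms_eigenvalue a f :
  (forall j, x j != 0 -> chart iota x j (f / x j ^+ a)) ->
  exists q (C : 'M[K]_q), (forall i j, forms a (C i j)) /\ eigenvalue C f.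
Proof.
move=> /forms_section[M HM]; have [q [e [Se gen]]] := forms_generators M.
have /choice[c Hc] i : exists c : 'I_q -> K,
    (forall j, forms a (c j)) /\ f * e i = \sum_j c j * e j.
  by have [c] := gen a _ (HM _ (Se i)); exists c.
exists q, (\matrix_(i, j) c j i); split.
  by move=> i j; rewrite mxE; case: (Hc j).
apply/eigenvalueP; exists (\row_i e i).
  apply/rowP => j; rewrite !mxE; have [_ ->] := Hc j.
  by apply: eq_bigr => i _; rewrite !mxE mulrC.
apply/eqP => e0; have [j xj0] := x_neq0.
have := gen 0%N (x j ^+ M); rewrite addn0 -[x j ^+ M]mulr1.
have := forms_coordX j M forms1; rewrite addn0 => Sx /(_ Sx)[d _].
rewrite mulr1 big1 => [/eqP|i _]; first by rewrite expf_eq0 (negPf xj0) andbF.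
by have /rowP/(_ i) := e0; rewrite !mxE => ->; rewrite mulr0.
Qed.

Lemma det_congr (B p : set K) q (M N : 'M[K]_q) :
  is_subalg iota B -> is_prime_ideal B p ->
  (forall i j, B (M i j) /\ B (N i j) /\ p (M i j - N i j)) ->
  p (\det M - \det N).
Proof.
move=> algB primep HMN.
suff : [/\ B (\det M), B (\det N) & p (\det M - \det N)] by case.
pose P y z := [/\ B y, B z & p (y - z)].
apply: (big_ind2 P).
- have B0 := subalg0 algB.
  by split; rewrite ?subrr//; apply: (prime0 primep).
- move=> y z y' z' [By Bz pyz] [By' Bz' pyz']; split; try exact: (subalgD algB).
  by rewrite opprD addrACA; apply: (primeD primep).
move=> s _.
have PM y z y' z' : P y z -> P y' z' -> P (y * y') (z * z').
  move=> [By Bz pyz] [By' Bz' pyz']; split; try exact: (subalgM algB).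
  have -> : y * y' - z * z' = y * (y' - z') + z' * (y - z) by ring.
  by apply: (primeD primep); apply: (primeMl primep).
have Pxx y : B y -> P y y by move=> By; split; rewrite // subrr; apply: (prime0 primep).
apply: (PM).
  by apply/Pxx/(subalgX algB)/(subalgN algB)/(subalg1 algB).
apply: (big_ind2 P).
- exact/Pxx/(subalg1 algB).
- by move=> y z y' z'; apply: PM.
by move=> i _; split; [exact: (HMN _ _).1|exact: (HMN _ _).2.1|exact: (HMN _ _).2.2].
Qed.

(** Nakayama's lemma: if p contained all x j ^+ a / f, then it would contain
    g / f for all forms g of degree a, and 1 would be an eigenvalue of a matrix
    with coefficients in p. *)
Lemma coord_notin_prime (B p : set K) a f : is_subalg iota B ->
  is_prime_ideal B p -> (0 < a)%N -> f != 0 ->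
  (forall j, x j != 0 -> chart iota x j (f / x j ^+ a)) ->
  (forall g, forms a g -> B (g / f)) ->
  exists j, ~ p (x j ^+ a / f).
Proof.
move=> algB primep a0 f0 Hf HB; apply/existsNP => Hp.
have pforms g : forms a g -> p (g / f).
  apply: (forms_ind (Q := fun g => p (g / f))).
  - by rewrite mul0r; apply: (prime0 primep).
  - by move=> h h' ph ph'; rewrite mulrDl; apply: (primeD primep).
  - move=> c l sl; rewrite -mulrA; apply: (primeMl primep); first by case: algB.
    have By : B (\prod_(j <- l) x j / f).
      by apply: HB; rewrite -sl; apply: forms_monomial.
    have [//|npy] := pselect (p (\prod_(j <- l) x j / f)); exfalso.
    have : ~ p ((\prod_(j <- l) x j / f) ^+ a).
      elim: (a) => [|b IHb]; first by rewrite expr0; apply: (prime1 primep).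
      rewrite exprS; apply: (prime_notM primep) => //; exact: (subalgX algB).
    apply; rewrite expr_div_n -prodrXl.
    have -> : f ^+ a = \prod_(j <- l) f.
      by rewrite big_const_seq count_predT sl -Monoid.iteropE.
    rewrite -prodf_div; case: l sl {By npy} => [|j l] sl; first by rewrite -sl in a0.
    rewrite big_cons mulrC; apply: (primeMl primep) => //.
    elim/big_ind: _ => [||i _]; first exact: (subalg1 algB).
      exact: (subalgM algB).
    exact: (prime_sub primep).
have [q [C [SC /eigenvalueP[u uC u0]]]] := forms_eigenvalue Hf.
have det0 : \det (1%:M - f^-1 *: C) = 0.
  apply/eqP/det0P; exists u => //.
  by rewrite mulmxBr mulmx1 -scalemxAr uC scalerA mulVf// scale1r subrr.
have := @det_congr B p q (1%:M - f^-1 *: C) 1%:M algB primep.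
rewrite det1 det0 sub0r => H.
apply: (prime1 primep); rewrite -[1]opprK; apply: (primeN algB primep).
apply: H => i j; rewrite !mxE.
have p1 := pforms _ (SC i j); rewrite mulrC in p1.
have B1 : B (i == j)%:R by case: (i == j); [apply: (subalg1 algB)|apply: (subalg0 algB)].
split; last split=> //.
- by apply: (subalgB algB) => //; apply: (prime_sub primep).
- by rewrite addrAC subrr sub0r; apply: (primeN algB primep).
Qed.

End Graded.

(** A global regular function is integral over the algebraically closed field
    of constants. *)
Lemma regular_const (k : closedFieldType) (K : fieldType)
    (iota : {rmorphism k -> K}) n (x : 'I_n.+1 -> K) f :
  (exists j, x j != 0) -> (forall j, x j != 0 -> chart iota x j f) ->
  exists a, f = iota a.
Proof.
move=> x0 Hf; have [|q [C [SC]]] := @forms_eigenvalue _ _ iota _ _ x0 0%N f.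
  by move=> j xj0; rewrite expr0 divr1; apply: Hf.
have /choice[c Hc] i : exists c : 'I_q -> k, forall j, iota (c j) = C i j.
  have /choice[c Hc] j : exists b, iota b = C i j by have [b] := SC i j; exists b.
  by exists c.
have -> : C = map_mx iota (\matrix_(i, j) c i j) by apply/matrixP => i j; rewrite !mxE.
rewrite eigenvalue_root_char -map_char_poly.
set P := char_poly _; have [r ->] := closed_field_poly_normal P.
rewrite (monicP (char_poly_monic _)) scale1r rmorph_prod/=.
rewrite (eq_bigr (fun z => 'X - (iota z)%:P)); last first.
  by move=> z _; rewrite map_polyXsubC.
rewrite -(big_map iota predT (fun z => 'X - z%:P)) root_prod_XsubC.
by case/mapP=> a _ ->; exists a.
Qed.

(** * Points, centers and sections *)

Section Units.
Variables (k K : fieldType) (iota : {rmorphism k -> K}) (O : set K).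
Hypothesis algO : is_subalg iota O.

Lemma unit_inM f g : is_unit_in O f -> is_unit_in O g -> is_unit_in O (f * g).
Proof.
move=> [f0 Of Of'] [g0 Og Og']; split; first exact: mulf_neq0.
  exact: (subalgM algO).
by rewrite invfM; apply: (subalgM algO).
Qed.

Lemma unit_inV f : is_unit_in O f -> is_unit_in O f^-1.
Proof. by move=> [f0 Of Of']; split; rewrite ?invr_eq0 ?invrK. Qed.

Lemma unit_in1 : is_unit_in O 1.
Proof. by split; rewrite ?oner_neq0 ?invr1//; apply: (subalg1 algO). Qed.

Lemma unit_inX f n : is_unit_in O f -> is_unit_in O (f ^+ n).
Proof.
move=> Uf; elim: n => [|n IHn]; first by rewrite expr0; apply: unit_in1.
by rewrite exprS; apply: unit_inM.
Qed.

End Units.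

Section Points.
Variables (k : closedFieldType) (X : projVariety k).
Local Notation K := (funField X).
Local Notation iota := (kconst X).

Lemma point_subalg O : points O -> is_subalg iota O.
Proof.
move=> [i [p [_ primep ->]]]; apply: localize_subalg => //.
exact: chart_subalg.
Qed.

Lemma exists_point : exists O : set K, points O.
Proof.
have [i xi0] := hcoord_neq0 X.
exists (localize (chart iota (@hcoord k X) i) [set 0]), i, [set 0]; split => //.
have algC := chart_subalg iota (@hcoord k X) i.
split.
- by move=> _ ->; apply: (subalg0 algC).
- by split => //= /eqP; rewrite oner_eq0.
- by move=> f g /= -> ->; rewrite addr0.
- by move=> a f /= _ ->; rewrite mulr0.
- by move=> f g _ _ /= /eqP; rewrite mulf_eq0 => /orP[]/eqP; [left|right].
Qed.

Section Berkovich.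
Variables (R : realType) (v : berkovich X R).
Let O := bring v.
Let algO : is_subalg iota O := point_subalg (bringP v).

Lemma bval1 : bval v 1 = 0%E.
Proof. by have := bval_const v (oner_neq0 k); rewrite rmorph1. Qed.

Lemma bval0 : bval v 0 = +oo%E.
Proof. by apply/bval_pinfty; split; [apply: (subalg0 algO)|case; rewrite eqxx]. Qed.

Lemma bval_unit f : O f -> bval v f <> +oo%E -> is_unit_in O f.
Proof.
move=> Of vf; have [//|nu] := pselect (is_unit_in O f).
by case: vf; apply/bval_pinfty.
Qed.

Lemma bval_fin_num f : is_unit_in O f -> bval v f \is a fin_num.
Proof.
move=> Uf; have [_ Of _] := Uf; rewrite fin_numE; apply/andP; split; apply/eqP.
  by move/bval_ninfty; apply.
by move/bval_pinfty => -[_]; apply.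
Qed.

Lemma bvalX f n : O f -> bval v (f ^+ n) = (n%:R%:E * bval v f)%E.
Proof.
move=> Of; elim: n => [|n IHn]; first by rewrite expr0 bval1 mul0e.
rewrite exprS bvalM ?IHn//; last exact: (subalgX algO).
have : bval v f <> -oo%E by move/bval_ninfty; apply.
case: (bval v f) => [a| |]// _.
  by rewrite -!EFinM -EFinD; congr (_%:E); rewrite -[n.+1%:R]natr1; ring.
case: n {IHn} => [|n]; first by rewrite mul0e mul1e.
by rewrite !gt0_muley// ?lte_fin ?ltr0n.
Qed.

Lemma bvalV f : is_unit_in O f -> bval v f^-1 = (- bval v f)%E.
Proof.
move=> Uf; have [f0 Of Of'] := Uf.
have : (bval v f + bval v f^-1 = 0)%E by rewrite -bvalM// mulfV// bval1.
have /fineK <- := bval_fin_num Uf.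
have /fineK <- := bval_fin_num (unit_inV Uf).
by rewrite -EFinD => -[/eqP]; rewrite addrC addr_eq0 => /eqP ->.
Qed.

(** Properness of X: the coordinate with the smallest valuation is
    invertible at the center. *)
Lemma exists_center : exists c, is_center v c.
Proof.
have [i [p [xi0 primep eO]]] := bringP v.
set x := @hcoord k X in xi0 *.
have Ox j : O (x j / x i).
  rewrite /O eO; apply: (sub_localize (chart_subalg _ _ _) primep).
  exact: chart_coord.
have [j _ jmin] := @Order.TotalTheory.arg_minP _ _ _ i predT
  (fun j => bval v (x j / x i)) erefl.
have vj_fin : bval v (x j / x i) <> +oo%E.
  by move=> vj; have := jmin i erefl; rewrite divff// bval1 vj.
have Uj := bval_unit (Ox j) vj_fin.
have xj0 : x j != 0.
  by case: Uj => + _ _; apply: contraNneq => ->; rewrite mul0r.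
have vfin := bval_fin_num Uj.
have Cx l : O (x l / x j) /\ (0 <= bval v (x l / x j))%E.
  have -> : x l / x j = (x l / x i) * (x j / x i)^-1.
    by rewrite invf_div mulrA divfK.
  have [_ _ Oj'] := Uj.
  split; first exact: (subalgM algO).
  by rewrite (bvalM (Ox l) Oj') bvalV// sube_ge0; [exact: jmin|rewrite vfin].
have algC := chart_subalg iota x j.
have CO : chart iota x j `<=` [set f | O f /\ (0 <= bval v f)%E].
  apply: smallest_sub => [|_ [l _ <-]//]; split.
  - move=> a; split; first by case: algO.
    have [->|a0] := eqVneq a 0; first by rewrite rmorph0 bval0 leey.
    by rewrite bval_const.
  - move=> f g [Of vf] [Og vg]; split; first exact: (subalgB algO).
    apply: le_trans (bvalD Of (subalgN algO Og)); rewrite le_min vf/=.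
    rewrite -mulN1r bvalM//; last exact/(subalgN algO)/(subalg1 algO).
    by rewrite -(rmorphN1 iota) bval_const ?add0e// oppr_eq0 oner_eq0.
  - move=> f g [Of vf] [Og vg]; split; first exact: (subalgM algO).
    by rewrite bvalM// adde_ge0.
pose q : set K := [set f | chart iota x j f /\ (0 < bval v f)%E].
have primeq : is_prime_ideal (chart iota x j) q.
  split.
  - by move=> f [].
  - split; first by split; [apply: (subalg0 algC)|rewrite bval0].
    by case=> _; rewrite bval1 ltxx.
  - move=> f g [Cf vf] [Cg vg]; split; first exact: (subalgD algC).
    apply: lt_le_trans (bvalD (CO _ Cf).1 (CO _ Cg).1).
    by rewrite lt_min vf.
  - move=> a f Ca [Cf vf]; split; first exact: (subalgM algC).
    rewrite bvalM; [|exact: (CO _ Ca).1|exact: (CO _ Cf).1].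
    by apply: lte_paddl => //; exact: (CO _ Ca).2.
  - move=> f g Cf Cg [_]; have [Of vf] := CO _ Cf; have [Og vg] := CO _ Cg.
    rewrite bvalM//; move: vf; rewrite le_eqVlt => /predU1P[<-|vf]; last by left.
    by rewrite add0e; right.
have val_frac a b : chart iota x j a -> chart iota x j b -> ~ q b ->
    bval v (a / b) = bval v a.
  move=> Ca Cb qb; have [Ob vb] := CO _ Cb; have [Oa va] := CO _ Ca.
  have vb0 : bval v b = 0%E.
    move: vb; rewrite le_eqVlt => /predU1P[<-//|vb]; by case: qb.
  have Ub : is_unit_in O b by apply: bval_unit; rewrite ?vb0.
  by have [_ _ Ob'] := Ub; rewrite bvalM// bvalV// vb0 oppe0 adde0.
exists (localize (chart iota x j) q); split.
- by exists j, q; split.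
- move=> _ [a [b [Ca Cb qb ->]]]; rewrite val_frac//; exact: (CO _ Ca).2.
- move=> _ [a [b [Ca Cb qb ->]]]; rewrite val_frac//.
  rewrite (localize_max_ideal primeq)//.
  by split=> [|[]].
Qed.

Lemma berk_centerP : is_center v (berk_center v).
Proof. exact: getPex exists_center. Qed.

Lemma center_sub : berk_center v `<=` O.
Proof.
move=> f cf; have [//|/bval_ninfty vf] := pselect (O f).
by have [_ /(_ _ cf) + _] := berk_centerP; rewrite vf.
Qed.

Lemma center_unit f : is_unit_in (berk_center v) f -> bval v f = 0%E.
Proof.
move=> Uf; have [_ vge0 vgt0] := berk_centerP; have [_ cf _] := Uf.
apply/eqP; rewrite eq_le vge0// andbT leNgt; apply/negP.
by move/(vgt0 _ cf).1 => -[_].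
Qed.

End Berkovich.

Section Sections.
Variables (D : lineBundle X).

(** The point O' is a generization of O, so it belongs to all Zariski
    neighbourhoods of O. *)
Lemma frame_sub O O' : points O -> points O' -> O `<=` O' ->
  is_unit_in O' (frame D O / frame D O').
Proof.
move=> pO pO' sO; have [fs [[_ Ofs] H]] := frameP D pO.
by apply: H; split => // f /Ofs /sO.
Qed.

Lemma H0M e e' s t : H0 D e s -> H0 D e' t -> H0 D (e + e') (s * t).
Proof.
move=> Hs Ht O pO; rewrite exprD -mulf_div.
by apply: (subalgM (point_subalg pO)); [apply: Hs|apply: Ht].
Qed.

Lemma H0B e s t : H0 D e s -> H0 D e t -> H0 D e (s - t).
Proof.
move=> Hs Ht O pO; rewrite mulrBl.
by apply: (subalgB (point_subalg pO)); [apply: Hs|apply: Ht].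
Qed.

Lemma H0_0 e : H0 D e 0.
Proof. by move=> O pO; rewrite mul0r; apply: (subalg0 (point_subalg pO)). Qed.

Lemma H0_const a : H0 D 0 (iota a).
Proof. by move=> O pO; rewrite expr0 divr1; case: (point_subalg pO). Qed.

Lemma H0X e s n : H0 D e s -> H0 D (n * e) (s ^+ n).
Proof.
move=> Hs; elim: n => [|n IHn]; first by rewrite expr0 -(rmorph1 iota); apply: H0_const.
by rewrite exprS mulSn; apply: H0M.
Qed.

Variables (e N : nat) (x : 'I_N.+1 -> K).
Hypotheses (Hx : forall j, H0 D e (x j))
  (x_unit : forall O, points O -> exists j, is_unit_in O (x j / frame D O ^+ e))
  (x_model : proj_model iota x = @points k X).

Lemma emb_neq0 : exists j, x j != 0.
Proof.
have [P pP] := exists_point; have [j [xj _ _]] := x_unit pP.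
by exists j; apply: contraNneq xj => ->; rewrite mul0r.
Qed.

Lemma H0_forms a g : forms iota x a g -> H0 D (a * e) g.
Proof.
elim: a g => [|a IHa] g; first by move=> [c _ <-]; apply: H0_const.
move=> [p Sp ->]; elim/big_ind: _ => [|f h Hf Hh|j _]; first exact: H0_0.
  rewrite -[h]opprK; apply: H0B => //; rewrite -sub0r; apply: H0B => //.
  exact: H0_0.
by rewrite mulSn; apply: H0M; [apply: Hx|apply: IHa; apply: Sp].
Qed.

Lemma emb_frame i p : x i != 0 -> is_prime_ideal (chart iota x i) p ->
  let O := localize (chart iota x i) p in
  points O /\ is_unit_in O (x i / frame D O ^+ e).
Proof.
move=> xi0 primep O; have pO : points O by rewrite -x_model; exists i, p.
split => //; have [j Uj] := x_unit pO.
have algO := point_subalg pO; have f0 := frame_neq0 D pO.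
have xj0 : x j != 0 by case: Uj => + _ _; apply: contraNneq => ->; rewrite mul0r.
split; first by rewrite mulf_neq0// invr_eq0 expf_neq0.
  exact: Hx.
have [_ _ Uj'] := Uj.
have -> : (x i / frame D O ^+ e)^-1 = (x j / frame D O ^+ e)^-1 * (x j / x i).
  by rewrite !invf_div mulrA divfK.
apply: (subalgM algO) => //; apply: (sub_localize (chart_subalg _ _ _) primep).
exact: chart_coord.
Qed.

(** As x i ^+ a is a frame on the i-th chart, the quotient is regular at all
    points of this affine variety, hence belongs to its coordinate ring. *)
Lemma H0_chart (R : realType) a f i : H0 D (a * e) f -> x i != 0 ->
  chart iota x i (f / x i ^+ a).
Proof.
move=> Hf xi0; apply: (localize_all (chart_subalg iota x i) R) => p primep.
have [pO Ui] := emb_frame xi0 primep; set O := localize _ _ in pO Ui *.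
have algO := point_subalg pO; have f0 := frame_neq0 D pO.
have [_ _ Ui'] := unit_inX algO a Ui.
have := subalgM algO (Hf O pO) Ui'.
rewrite expr_div_n -exprM [(e * a)%N]mulnC invf_div mulrA divfK//.
by rewrite expf_neq0.
Qed.

Lemma H0_degree0 (R : realType) f : H0 D 0 f -> exists a, f = iota a.
Proof.
move=> Hf; apply: (regular_const emb_neq0) => j xj0.
by have := @H0_chart R 0 f j Hf xj0; rewrite expr0 divr1.
Qed.

End Sections.

End Points.

(** * Homogenization of a graded norm *)

Lemma cvg_ereal_lower (R : realType) (T : Type) (G : set_system T)
    {FG : Filter G} (u : T -> \bar R) (l : \bar R) :
  (forall a : R, (a%:E < l)%E -> \forall t \near G, (a%:E < u t)%E) ->
  (\forall t \near G, (u t <= l)%E) -> u @ G --> l.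
Proof.
move=> lower upper B; case: l lower upper => [r| |] lower upper.
- move=> nB; have /nbhs_ballP[e /= e0 rB] : nbhs r (fun y : R => B y%:E) := nB.
  have er : ((r - e)%:E < r%:E)%E by rewrite lte_fin gtrBl.
  apply: filterS2 (lower _ er) upper => t; rewrite /preimage/=.
  case: (u t) => [b| |]//; rewrite lte_fin lee_fin => reb br; apply: rB.
  by rewrite -ball_normE/= ger0_norm ?subr_ge0// ltrBlDr -ltrBlDl.
- move=> [M [_ MB]]; apply: filterS (lower M (ltry M)) => t; exact: MB.
- move=> [M [_ MB]]; apply: filterS upper => t; rewrite leeNy_eq /preimage/= => /eqP ->.
  by apply: MB; apply: ltNyr.
Qed.

Section GradedNorm.
Variables (k : closedFieldType) (X : projVariety k) (L : qLineBundle X).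
Local Notation K := (funField X).
Local Notation iota := (kconst X).

Lemma line_multD m m' : (qden L %| m)%N ->
  line_mult L (m + m') = (line_mult L m + line_mult L m')%N.
Proof. by move=> dm; rewrite /line_mult divnDl. Qed.

Lemma line_multM r m : (qden L %| m)%N -> line_mult L (r * m) = (r * line_mult L m)%N.
Proof. by move=> dm; rewrite /line_mult muln_divA. Qed.

Lemma sectionsM m m' s t : (qden L %| m)%N ->
  sections L m s -> sections L m' t -> sections L (m + m') (s * t).
Proof. by move=> dm Hs Ht; rewrite /sections line_multD//; apply: H0M. Qed.

Lemma sectionsX m r s : (qden L %| m)%N ->
  sections L m s -> sections L (r * m) (s ^+ r).
Proof. by move=> dm Hs; rewrite /sections line_multM//; apply: H0X. Qed.

Lemma sections_const a : sections L 0 (iota a).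
Proof. by rewrite /sections /line_mult div0n; apply: H0_const. Qed.

Variables (d : nat) (lvl : level L d).
Let dL : (qden L %| d)%N := lvl.2.

Lemma section_ring_monomial m s : (d %| m)%N -> sections L m s ->
  section_ring L d (s *: 'X^m).
Proof.
move=> dm Hs j; rewrite coefZ coefXn; case: eqP => [->|_].
  by rewrite mulr1 dm.
by rewrite mulr0; split=> //; apply: H0_0.
Qed.

Lemma section_ring_coef m f : section_ring L d f ->
  section_ring L d (f`_m *: 'X^m).
Proof.
move=> Hf; have [dm|dm] := boolP (d %| m)%N.
  by apply: section_ring_monomial => //; exact: (Hf m).1.
by have [_ ->//] := Hf m; rewrite scale0r => j; rewrite coef0; split=> //; apply: H0_0.
Qed.

Lemma section_ring0 : section_ring L d 0.
Proof. by move=> m; rewrite coef0; split=> //; apply: H0_0. Qed.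

Lemma section_ringB f g :
  section_ring L d f -> section_ring L d g -> section_ring L d (f - g).
Proof.
move=> Hf Hg m; have [f1 f2] := Hf m; have [g1 g2] := Hg m; rewrite coefB.
by split=> [|dm]; [apply: H0B|rewrite f2// g2// subr0].
Qed.

Lemma section_ring1 : section_ring L d 1.
Proof.
have -> : 1 = 1 *: 'X^0 :> {poly K} by rewrite expr0 scale1r.
apply: section_ring_monomial => //.
by rewrite -(rmorph1 iota); apply: sections_const.
Qed.

Lemma section_ringM f g :
  section_ring L d f -> section_ring L d g -> section_ring L d (f * g).
Proof.
move=> Hf Hg m; rewrite coefM; split=> [|dm].
  elim/big_ind: _ => [|y z Hy Hz|j _]; first exact: H0_0.
    rewrite -[z]opprK; apply: H0B => //; rewrite -sub0r; apply: H0B => //.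
    exact: H0_0.
  have [dj|/(Hf j).2->] := boolP (d %| j)%N; last by rewrite mul0r; apply: H0_0.
  have jm : (j <= m)%N by rewrite -ltnS.
  suff : sections L (j + (m - j)) (f`_j * g`_(m - j)) by rewrite subnKC.
  apply: sectionsM; last exact: (Hg _).1.
    exact: dvdn_trans dL dj.
  exact: (Hf _).1.
apply: big1 => j _; have [dj|/(Hf j).2->] := boolP (d %| j)%N; last by rewrite mul0r.
have [dmj|/(Hg _).2->] := boolP (d %| m - j)%N; last by rewrite mulr0.
have jm : (j <= m)%N by rewrite -ltnS.
by have := dvdn_add dj dmj; rewrite subnKC ?(negPf dm).
Qed.

Lemma section_ringX f n : section_ring L d f -> section_ring L d (f ^+ n).
Proof.
move=> Hf; elim: n => [|n IHn]; first by rewrite expr0; apply: section_ring1.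
by rewrite exprS; apply: section_ringM.
Qed.

Variables (R : realType) (chi : {poly K} -> \bar R) (hchi : is_gnorm L d chi).

Lemma gnorm0 : chi 0 = +oo%E.
Proof. by apply/(gnorm_pinfty hchi) => //; apply: section_ring0. Qed.

Lemma gnormN f : section_ring L d f -> chi (- f) = chi f.
Proof.
move=> Hf; have := gnormZ hchi (a := -1) _ Hf; rewrite oppr_eq0 oner_eq0 => /(_ erefl).
by rewrite rmorphN1 scaleN1r.
Qed.

Lemma gnormX f n : section_ring L d f -> (0 < n)%N ->
  (n%:R%:E * chi f <= chi (f ^+ n))%E.
Proof.
move=> Hf; elim: n => // -[_ _|n IHn _]; first by rewrite mul1e expr1.
rewrite exprS; apply: le_trans (gnormM hchi Hf (section_ringX n.+1 Hf)).
apply: le_trans (leeD2l _ (IHn erefl)); have := gnorm_ninfty hchi Hf.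
case: (chi f) => [a| |]// _; last by rewrite !gt0_muley ?lte_fin ?ltr0n.
by rewrite -!EFinM -EFinD lee_fin -[n.+2%:R]natr1 mulrDl mul1r addrC lexx.
Qed.

Lemma gnorm_le_coef f m : section_ring L d f -> (chi f <= chi (f`_m *: 'X^m))%E.
Proof.
move=> Hf; have [mf|fm] := ltnP m (size f); last first.
  by rewrite nth_default// scale0r gnorm0 leey.
rewrite (gnorm_graded hchi Hf).
exact: (bigmin_le _ (Ordinal mf)).
Qed.

Definition gnorm_filt (a : R) : set {poly K} :=
  [set f | section_ring L d f /\ (a%:E <= chi f)%E].

Lemma gnorm_filtration : filtration gnorm_filt.
Proof.
split.
- by move=> a b f ab [Hf bf]; split => //; apply: le_trans bf; rewrite lee_fin.
- by move=> a; split; [exact: section_ring0|rewrite gnorm0 leey].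
- move=> a f g [Hf af] [Hg ag]; split; first exact: section_ringB.
  have HNg : section_ring L d (- g).
    by rewrite -sub0r; apply: section_ringB => //; apply: section_ring0.
  by apply: le_trans (gnormD hchi Hf HNg); rewrite gnormN// le_min af.
- move=> a b f g [Hf af] [Hg bg]; split; first exact: section_ringM.
  by apply: le_trans (gnormM hchi Hf Hg); rewrite EFinD leeD.
- have := gnorm_ninfty hchi section_ring1.
  case e : (chi 1) => [a| |]// _.
    by exists a; split; [exact: section_ring1|rewrite e].
  by exists 0; split; [exact: section_ring1|rewrite e leey].
- move=> a a0 [_]; have := gnormM hchi section_ring1 section_ring1; rewrite mulr1.
  have := gnorm_ninfty hchi section_ring1.
  have : chi 1 <> +oo%E.
    by move/(gnorm_pinfty hchi section_ring1)/eqP; rewrite oner_eq0.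
  case: (chi 1) => [b| |]// _ _; rewrite -EFinD !lee_fin; lra.
Qed.

Let Fchi := gnorm_filtration.

Lemma gnorm_filt_dom f : section_ring L d f -> filt_dom gnorm_filt f.
Proof.
move=> Hf; have := gnorm_ninfty hchi Hf; case e : (chi f) => [a| |]// _.
  by exists a; split; rewrite ?e.
by exists 0; split; rewrite ?e ?leey.
Qed.

(** Fekete's lemma for the superadditive sequence chi (f ^+ r). *)
Lemma homogenize_cvg_sup f : section_ring L d f ->
  (r%:R^-1%:E * chi (f ^+ r))%E @[r --> \oo] -->
    ereal_sup (EFin @` [set a | filt_hom gnorm_filt a f]).
Proof.
move=> Hf.
apply: cvg_ereal_lower; last first.
  near=> r; apply: lee_EFin_lower => a.
  have r0 : (0 < r)%N by near: r; apply: nbhs_infty_gt.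
  rewrite lee_pdivlMl ?ltr0n// -EFinM => ar; apply: ereal_sup_ubound; exists a => //=.
  apply: (filt_hom_root Fchi r0); first exact: gnorm_filt_dom.
  by split => //; apply: section_ringX.
move=> a /ereal_sup_gt[_ [b Hb <-]]; rewrite lte_fin => ab.
have e0 : 0 < (b - a) / 2 by rewrite divr_gt0// subr_gt0.
have [C HC] := Hb _ e0.
near=> r.
have r0 : (0 < r)%N by near: r; apply: nbhs_infty_gt.
have -> : a%:E = (r%:R^-1%:E * (r%:R * a)%:E)%E.
  by rewrite -EFinM mulKf// pnatr_eq0 -lt0n.
rewrite lte_pmul2l// ?lte_fin ?invr_gt0 ?ltr0n//.
apply: lt_le_trans (HC r).2; rewrite lte_fin ltrBrDr -ltrBrDl -mulrBr.
have -> : b - (b - a) / 2 - a = (b - a) / 2 by field.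
rewrite -ltr_pdivrMr//; near: r; exact: nbhs_infty_gtr.
Unshelve. all: by end_near. Qed.

Lemma homogenizeP f a : section_ring L d f ->
  filt_hom gnorm_filt a f <-> (a%:E <= homogenize chi f)%E.
Proof.
move=> Hf; rewrite /homogenize (cvg_lim _ (homogenize_cvg_sup Hf))//.
split=> [Ha|le_a]; first by apply: ereal_sup_ubound; exists a.
apply: filt_hom_closed_hom => e e0.
have /ereal_sup_gt[_ [b Hb <-]] : ((a - e)%:E <
    ereal_sup (EFin @` [set a | filt_hom gnorm_filt a f]))%E.
  by apply: lt_le_trans le_a; rewrite lte_fin gtrBl.
by rewrite lte_fin => /ltW /(filt_anti (filt_hom_filtration Fchi)); apply.
Qed.

Lemma gnorm_le_homogenize f : section_ring L d f -> (chi f <= homogenize chi f)%E.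
Proof.
move=> Hf; apply: lee_EFin_lower => a af; apply/(homogenizeP _ Hf).
by apply: (filt_sub_hom Fchi).
Qed.

Lemma homogenize_le f (c : R) : section_ring L d f ->
  (forall r, (0 < r)%N -> (chi (f ^+ r) <= (r%:R * c)%:E)%E) ->
  (homogenize chi f <= c%:E)%E.
Proof.
move=> Hf Hc; apply: lime_le; first by apply: cvgP; exact: homogenize_cvg_sup Hf.
near=> r; have r0 : (0 < r)%N by near: r; apply: nbhs_infty_gt.
by rewrite lee_pdivrMl ?ltr0n// -EFinM Hc.
Unshelve. all: by end_near. Qed.

Lemma homogenize0 : homogenize chi 0 = +oo%E.
Proof.
by apply/eqP; rewrite -leye_eq -{1}gnorm0; apply/gnorm_le_homogenize/section_ring0.
Qed.

(** The lowest homogeneous term of a power is the power of the lowest term. *)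
Lemma filt_hom_lowest a m g : filt_hom gnorm_filt a ('X^m * g) ->
  filt_hom gnorm_filt a (g`_0 *: 'X^m).
Proof.
move=> Ha e e0; have [C HC] := Ha e e0; exists C => i; have [SRi ai] := HC i.
have := gnorm_le_coef (m * i)%N SRi; have := section_ring_coef (m * i)%N SRi.
have -> : (('X^m * g) ^+ i)`_(m * i) = g`_0 ^+ i.
  rewrite exprMn -exprM coefXnM ltnn subnn -!horner_coef0.
  by rewrite horner_exp.
rewrite exprM -exprZn => SR' le_i; split => //; exact: le_trans ai le_i.
Qed.

Lemma filt_hom_coef a m f : filt_hom gnorm_filt a f ->
  filt_hom gnorm_filt a (f`_m *: 'X^m).
Proof.
elim/ltn_ind: m f => m IHm f Ha.
have -> : f`_m = (drop_poly m f)`_0 by rewrite coef_drop_poly add0n.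
apply: filt_hom_lowest; rewrite ['X^m * _]mulrC.
have -> : drop_poly m f * 'X^m = f - take_poly m f.
  by rewrite -{2}(poly_take_drop m f) addrAC subrr add0r.
have Fhom := filt_hom_filtration Fchi.
apply: (filtB Fhom) => //; rewrite /take_poly poly_def.
by apply: (filt_sum Fhom) => j _; apply: IHm.
Qed.

Lemma homogenize_graded f : section_ring L d f -> homogenize chi f =
  \big[Order.min/+oo%E]_(m < size f) homogenize chi (f`_m *: 'X^m).
Proof.
move=> Hf; apply/le_anti/andP; split.
  apply: le_bigmin => [|m _]; first exact: leey.
  apply: lee_EFin_lower => a /(homogenizeP _ Hf) Ha.
  apply/homogenizeP; first exact: section_ring_coef.
  exact: filt_hom_coef.
apply: lee_EFin_lower => a Ha; apply/(homogenizeP _ Hf).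
rewrite -[f]coefK poly_def; apply: (filt_sum (filt_hom_filtration Fchi)) => m _.
apply/homogenizeP; first exact: section_ring_coef.
by apply: le_trans Ha _; apply: (bigmin_le _ m).
Qed.

Lemma homogenize_const a : a != 0 -> homogenize chi (iota a *: 'X^0) = 0%E.
Proof.
move=> a0; have pw r : (iota a *: 'X^0) ^+ r = iota (a ^+ r) *: 1 :> {poly K}.
  by rewrite exprZn rmorphXn -exprM mul0n.
have chi1 r : chi ((iota a *: 'X^0) ^+ r) = chi 1.
  by rewrite pw (gnormZ hchi) ?expf_neq0//; apply: section_ring1.
have Ha : section_ring L d (iota a *: 'X^0).
  by apply: section_ring_monomial => //; apply: sections_const.
apply/le_anti/andP; split.
  apply: homogenize_le => // r r0; rewrite chi1 mulr0 leNgt; apply/negP => chi_gt0.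
  have := gnorm_ninfty hchi section_ring1.
  have : chi 1 <> +oo%E.
    by move/(gnorm_pinfty hchi section_ring1)/eqP; rewrite oner_eq0.
  case e : (chi 1) chi_gt0 => [b| |]//; rewrite lte_fin => b0 _ _.
  by apply: (filt_bounded Fchi b0); split; [exact: section_ring1|rewrite e].
apply/(homogenizeP _ Ha) => e e0; have [C HC] := filt_hom1 Fchi e0.
exists C => i; split; first exact: section_ringX.
by rewrite chi1; have := (HC i).2; rewrite expr1n.
Qed.

(** The linear bounds on chi carry over to its homogenization. *)
Lemma homogenize_fin m s : (0 < m)%N -> (d %| m)%N -> sections L m s -> s != 0 ->
  homogenize chi (s *: 'X^m) \is a fin_num.
Proof.
move=> m0 dm Hs s0; have [C C0 HC] := gnorm_linear hchi.
have HSR := section_ring_monomial dm Hs.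
have pw r : (s *: 'X^m) ^+ r = s ^+ r *: 'X^(r * m) by rewrite exprZn -exprM mulnC.
rewrite fin_numElt; apply/andP; split.
  apply: lt_le_trans (gnorm_le_homogenize HSR).
  by rewrite ltNye_eq; have := HC m s m0 dm Hs s0; case: (chi _).
apply: (@le_lt_trans _ _ (C * m%:R)%:E); last exact: ltry.
apply: homogenize_le => // r r0; rewrite pw.
have := HC (r * m)%N (s ^+ r).
rewrite muln_gt0 r0 m0 dvdn_mull// expf_neq0// => /(_ erefl erefl).
move=> /(_ (sectionsX r (dvdn_trans dL dm) Hs) erefl).
by rewrite mulrCA -natrM; apply: le_trans (lee_abs _).
Qed.

End GradedNorm.

(** * The Fubini--Study operator *)

Lemma divisibly_proper : ProperFilter divisibly.
Proof.
apply: filter_from_proper => [|d d0]; last by exists d; split.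
apply: filter_from_filter => [|d d' d0 d'0]; first by exists 1%N.
exists (d * d')%N; first by rewrite /= muln_gt0 d0.
move=> m [m0 dm]; split; split => //; apply: dvdn_trans dm.
  exact: dvdn_mulr.
exact: dvdn_mull.
Qed.

Section FubiniStudy.
Variables (k : closedFieldType) (X : projVariety k) (L : qLineBundle X).
Local Notation K := (funField X).
Local Notation iota := (kconst X).
Variable (R : realType).

Section SectionValue.
Variables (v : berkovich X R) (m : nat) (s : K).
Hypotheses (Hs : sections L m s).
Let c := berk_center v.

Lemma section_center : c (s / frame (qbase L) c ^+ line_mult L m).
Proof. by apply: Hs; case: (berk_centerP v). Qed.

Lemma sect_val_ge0 : (0 <= sect_val L v m s)%E.
Proof. by have [_ + _] := berk_centerP v; apply; apply: section_center. Qed.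

Lemma sect_valX r : (qden L %| m)%N ->
  sect_val L v (r * m) (s ^+ r) = (r%:R%:E * sect_val L v m s)%E.
Proof.
move=> dm; rewrite /sect_val line_multM// -bvalX; last first.
  by apply: center_sub; apply: section_center.
by rewrite expr_div_n -exprM mulnC.
Qed.

End SectionValue.

Variables (m0 N : nat) (x : 'I_N.+1 -> K).
Hypotheses (m0_gt0 : (0 < m0)%N) (m0_den : (qden L %| m0)%N).
Let e := line_mult L m0.
Hypotheses (Hx : forall j, H0 (qbase L) e (x j))
  (x_unit : forall O, points O ->
    exists j, is_unit_in O (x j / frame (qbase L) O ^+ e))
  (x_model : proj_model iota x = @points k X).
Variables (d : nat) (lvl : level L d) (chi : {poly K} -> \bar R).
Hypothesis hchi : is_gnorm L d chi.
Let D := (d * m0)%N.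

Let D_gt0 : (0 < D)%N. Proof. by rewrite muln_gt0 lvl.1. Qed.

Section Limit.
Variable v : berkovich X R.

Lemma FS_term_ge m s : (0 < m)%N -> sections L m s -> s != 0 ->
  (log_abs L v m s + chi (s *: 'X^m) <= m%:R%:E * FS_term L chi v m)%E.
Proof.
move=> m_gt0 Hs s0; rewrite /FS_term muleA -EFinM mulfV ?pnatr_eq0 -?lt0n// mul1e.
by apply: ereal_sup_ubound; exists s.
Qed.

Lemma FS_term_le m b : (0 < m)%N ->
  (forall s, sections L m s -> s != 0 ->
    (log_abs L v m s + chi (s *: 'X^m) <= (m%:R * b)%:E)%E) ->
  (FS_term L chi v m <= b%:E)%E.
Proof.
move=> m_gt0 Hb; rewrite /FS_term lee_pdivrMl ?ltr0n// -EFinM.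
by apply: ge_ereal_sup => _ [s [Hs s0] <-]; apply: Hb.
Qed.

(** A section s of mL gives the section s ^+ r of rmL, so that the limit over
    divisible m is a supremum. *)
Lemma FS_term_mono m r : (0 < m)%N -> (0 < r)%N -> (d %| m)%N ->
  (FS_term L chi v m <= FS_term L chi v (r * m))%E.
Proof.
move=> m_gt0 r_gt0 dm.
have rm_gt0 : (0 < r * m)%N by rewrite muln_gt0 r_gt0.
have qm := dvdn_trans lvl.2 dm.
rewrite {1}/FS_term lee_pdivrMl ?ltr0n//.
apply: ge_ereal_sup => _ [s [Hs s0] <-].
have := FS_term_ge rm_gt0 (sectionsX r qm Hs) (expf_neq0 r s0).
have -> : s ^+ r *: 'X^(r * m) = (s *: 'X^m) ^+ r by rewrite exprZn -exprM mulnC.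
have := gnormX lvl hchi (section_ring_monomial dm Hs) r_gt0.
rewrite /log_abs sect_valX// natrM EFinM -muleA => le1 le2.
rewrite -(@lee_pmul2l _ r%:R%:E) ?lte_fin ?ltr0n//.
apply: le_trans le2; apply: le_trans (leeD2l _ le1).
have := sect_val_ge0 v Hs; have := gnorm_ninfty hchi (section_ring_monomial dm Hs).
case: (sect_val L v m s) => [a| |]//; case: (chi _) => [b| |]// _ _.
- by rewrite -!EFinM -!EFinD lee_fin mulrDr mulrN.
- by rewrite addey// gt0_muley ?lte_fin ?ltr0n// addey// leey.
- by rewrite gt0_muley ?lte_fin ?ltr0n//= gt0_muleNy ?lte_fin ?ltr0n.
- by rewrite gt0_muley ?lte_fin ?ltr0n//= gt0_muleNy ?lte_fin ?ltr0n.
Qed.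

Definition FS_sup : \bar R :=
  ereal_sup (FS_term L chi v @` [set m | (0 < m)%N /\ (D %| m)%N]).

Lemma FS_cvg : FS_term L chi v @ divisibly --> FS_sup.
Proof.
have ? := divisibly_proper.
apply: cvg_ereal_lower => [a /ereal_sup_gt[_ [m [m_gt0 Dm] <-] am]|].
  exists m => // m' [m'0 /dvdnP[r em']]; apply: lt_le_trans am _.
  rewrite em'; apply: FS_term_mono => //.
    by move: m'0; rewrite em' muln_gt0 => /andP[].
  by apply: dvdn_trans Dm; apply: dvdn_mulr.
by exists D => // m [m_gt0 Dm]; apply: ereal_sup_ubound; exists m.
Qed.

(** Finiteness of the limit: the bound from below holds because some power of
    a coordinate does not vanish at the center of v. *)
Lemma FS_sup_fin : FS_sup \is a fin_num.
Proof.
have [C C0 HC] := gnorm_linear hchi.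
rewrite fin_numElt; apply/andP; split; last first.
  apply: (@le_lt_trans _ _ C%:E); last exact: ltry.
  apply: ge_ereal_sup => _ [m [m_gt0 Dm] <-]; apply: FS_term_le => // s Hs s0.
  have dm : (d %| m)%N by apply: dvdn_trans Dm; apply: dvdn_mulr.
  have := HC m s m_gt0 dm Hs s0; rewrite mulrC => /(le_trans (lee_abs _)).
  by apply: le_trans; apply: geeDr; rewrite /log_abs oppe_le0 sect_val_ge0.
apply: (@lt_le_trans _ _ (- C)%:E); first exact: ltNyr.
apply: (@le_trans _ _ (FS_term L chi v D)); last first.
  by apply: ereal_sup_ubound; exists D.
have [j Uj] := x_unit (let: And3 p _ _ := berk_centerP v in p).
have pc : points (berk_center v) by case: (berk_centerP v).
have xj0 : x j ^+ d != 0.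
  case: Uj => + _ _; apply: contraNneq => /eqP; rewrite expf_eq0.
  by case/andP=> _ /eqP ->; rewrite mul0r.
have Hxj : sections L D (x j ^+ d) by apply: sectionsX => //; apply: Hx.
have val0 : sect_val L v D (x j ^+ d) = 0%E.
  apply: center_unit; rewrite /D line_multM// [(d * _)%N]mulnC exprM -expr_div_n.
  exact: (unit_inX (point_subalg pc)).
have := FS_term_ge D_gt0 Hxj xj0.
rewrite /log_abs val0 oppe0 add0e => le1.
have DR : 0 < D%:R :> R by rewrite ltr0n.
rewrite -(@lee_pmul2l _ D%:R%:E) ?lte_fin//; apply: le_trans le1.
have := HC D _ D_gt0 (dvdn_mulr _ (dvdnn d)) Hxj xj0.
rewrite -EFinM mulrN mulrC; case: (chi _) => [b| |]//.
by rewrite !lee_fin ler_norml => /andP[].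
Qed.

Lemma FS_E : (FS L chi v)%:E = FS_sup.
Proof.
have ? := divisibly_proper.
by rewrite /FS (cvg_lim _ FS_cvg)// fineK// FS_sup_fin.
Qed.

Lemma FS_le b :
  (forall m s, (0 < m)%N -> (D %| m)%N -> sections L m s -> s != 0 ->
    (log_abs L v m s + chi (s *: 'X^m) <= (m%:R * b)%:E)%E) ->
  FS L chi v <= b.
Proof.
move=> Hb; rewrite -lee_fin FS_E; apply: ge_ereal_sup => _ [m [m_gt0 Dm] <-].
by apply: FS_term_le => // s; apply: Hb.
Qed.

(** The inequality chi^hom <= IN (FS chi): a power of s contributes to the
    supremum defining FS chi. *)
Lemma homogenize_le_FS m s : (0 < m)%N -> (D %| m)%N -> sections L m s -> s != 0 ->
  (homogenize chi (s *: 'X^m) <= sect_val L v m s + (m%:R * FS L chi v)%:E)%E.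
Proof.
move=> m_gt0 Dm Hs s0.
have dm : (d %| m)%N by apply: dvdn_trans Dm; apply: dvdn_mulr.
have qm := dvdn_trans lvl.2 dm.
have := sect_val_ge0 v Hs; case vs : (sect_val L v m s) => [a| |]// _; last first.
  by rewrite addye// leey.
rewrite -EFinD; apply: (homogenize_le lvl hchi) => [|r r_gt0].
  exact: section_ring_monomial.
have rm_gt0 : (0 < r * m)%N by rewrite muln_gt0 r_gt0.
have le1 := FS_term_ge rm_gt0 (sectionsX r qm Hs) (expf_neq0 r s0).
have : (FS_term L chi v (r * m) <= (FS L chi v)%:E)%E.
  rewrite FS_E; apply: ereal_sup_ubound; exists (r * m)%N => //.
  by split => //; apply: dvdn_mull.
have rmR : (0 < (r * m)%:R%:E :> \bar R)%E by rewrite lte_fin ltr0n.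
rewrite -(lee_pmul2l _ rmR)// => /(le_trans le1).
have -> : s ^+ r *: 'X^(r * m) = (s *: 'X^m) ^+ r by rewrite exprZn -exprM mulnC.
rewrite /log_abs sect_valX// vs -!EFinM addeC leeBlDr// -EFinD.
by congr (_ <= _%:E)%E; rewrite natrM; ring.
Qed.

End Limit.

End FubiniStudy.

(** * The valuation computing the homogenization *)

Section BerkovichOfFiltration.
Variables (k : closedFieldType) (X : projVariety k) (R : realType).
Local Notation K := (funField X).
Local Notation iota := (kconst X).
Variables (G : R -> set K) (maxG : filt_max G).
Variables (A : set K) (algA : is_subalg iota A) (AG : A `<=` filt_dom G).

Lemma berkovich_of_filtration :
  (forall a, a != 0 -> filt_val G (iota a) = 0%E) ->
  points (localize A (filt_kernel A G)) ->
  exists v : berkovich X R, bring v = localize A (filt_kernel A G) /\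
    forall f, bring v f -> bval v f = filt_val G f.
Proof.
move=> vconst; set B := localize _ _ => pB.
have algB : is_subalg iota B := point_subalg pB.
have Bdom f : B f -> filt_dom G f by apply: localize_filt_dom.
pose w f := if `[< B f >] then filt_val G f else -oo%E.
have wB f : B f -> w f = filt_val G f by move=> Bf; rewrite /w asboolT.
have w_pinfty f : w f = +oo%E <-> max_ideal B f.
  have [Bf|nBf] := pselect (B f).
    by rewrite wB//; apply: (localize_filt_max algA maxG AG Bf).
  by rewrite /w asboolF//; split=> // -[].
have w_ninfty f : w f = -oo%E <-> ~ B f.
  split=> [wf Bf|nBf]; last by rewrite /w asboolF.
  by have /(filt_val_dom maxG) := Bdom _ Bf; rewrite -wB.
have w_const a : a != 0 -> w (iota a) = 0%E.
  by move=> a0; rewrite wB ?vconst//; case: algB.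
have wM f g : B f -> B g -> w (f * g) = (w f + w g)%E.
  move=> Bf Bg; rewrite !wB//; last exact: (subalgM algB).
  by rewrite filt_valM//; apply: Bdom.
have wD f g : B f -> B g -> (Order.min (w f) (w g) <= w (f + g)%R)%E.
  move=> Bf Bg; rewrite !wB//; last exact: (subalgD algB).
  exact: filt_valD.
by exists (Berkovich pB w_pinfty w_ninfty w_const wM wD).
Qed.

End BerkovichOfFiltration.

Section Attainment.
Variables (k : closedFieldType) (X : projVariety k) (L : qLineBundle X).
Local Notation K := (funField X).
Local Notation iota := (kconst X).
Variable (R : realType).
Variables (m0 N : nat) (x : 'I_N.+1 -> K).
Hypotheses (m0_gt0 : (0 < m0)%N) (m0_den : (qden L %| m0)%N).
Let e := line_mult L m0.
Hypotheses (Hx : forall j, H0 (qbase L) e (x j))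
  (x_unit : forall O, points O ->
    exists j, is_unit_in O (x j / frame (qbase L) O ^+ e))
  (x_model : proj_model iota x = @points k X).
Variables (d : nat) (lvl : level L d) (chi : {poly K} -> \bar R).
Hypothesis hchi : is_gnorm L d chi.
Let D := (d * m0)%N.

Section FixedSection.
Variables (m : nat) (s : K) (c : R).
Hypotheses (m_gt0 : (0 < m)%N) (Dm : (D %| m)%N).
Hypotheses (Hs : sections L m s) (s_neq0 : s != 0).
Hypothesis (hc : homogenize chi (s *: 'X^m) = c%:E).

Let dm : (d %| m)%N. Proof. by apply: dvdn_trans Dm; apply: dvdn_mulr. Qed.
Let qm : (qden L %| m)%N. Proof. exact: dvdn_trans lvl.2 dm. Qed.
Let H := filt_hom (gnorm_filt L d chi).
Let filtH : filtration H := filt_hom_filtration (gnorm_filtration lvl hchi).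
Let HSR : section_ring L d (s *: 'X^m).
Proof. exact: section_ring_monomial. Qed.

(** On the complement of the divisor of s, the fraction t / s ^+ n has the
    value chi^hom (t) - n chi^hom (s). *)
Definition section_filt (a : R) : set K :=
  [set f | exists n : nat, H (a + n%:R * c) ((f * s ^+ n) *: 'X^(n * m))].

(** The element 1 has no positive value because chi^hom (s ^+ n) = n c; the
    analogue for chi, with c = chi (s), would fail here. *)
Lemma section_filtration : filtration section_filt.
Proof.
have Hsc : H c (s *: 'X^m) by apply/(homogenizeP lvl hchi _ HSR); rewrite hc.
have raise b f n p : (n <= p)%N -> H (b + n%:R * c) ((f * s ^+ n) *: 'X^(n * m)) ->
    H (b + p%:R * c) ((f * s ^+ p) *: 'X^(p * m)).
  move=> /subnKC <-; elim: (p - n)%N => [|q IHq]; first by rewrite addn0.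
  move=> /IHq Hq; have := filtM filtH Hq Hsc; rewrite addnS.
  congr H; first by rewrite -[(n + q).+1%:R]natr1; ring.
  rewrite -scalerAl -scalerAr scalerA -exprD; congr (_ *: 'X^_).
    by rewrite [s ^+ _.+1]exprSr mulrA.
  by rewrite mulSn addnC.
split.
- move=> a b f ab [n Hn]; exists n; apply: (filt_anti filtH) Hn.
  by rewrite lerD2r.
- by move=> a; exists 0%N; rewrite !mul0r scale0r; apply: (filt0 filtH).
- move=> a f g [n Hn] [p Hp]; exists (maxn n p).
  rewrite mulrBl scalerBl; apply: (filtB filtH).
    by apply: raise Hn; rewrite leq_maxl.
  by apply: raise Hp; rewrite leq_maxr.
- move=> a b f g [n Hn] [p Hp]; exists (n + p)%N.
  have := filtM filtH Hn Hp; congr H; first by rewrite natrD; ring.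
  rewrite -scalerAl -scalerAr scalerA -exprD -mulnDl; congr (_ *: _).
  by rewrite exprD mulrACA.
- have [a Ha] := filt1 filtH; exists a, 0%N.
  by rewrite mul0r addr0 mul1r mul0n !expr0 scale1r.
- move=> a a0 [[|n]]; rewrite mul1r.
    by rewrite mul0r addr0 mul0n !expr0 scale1r; apply: (filt_bounded filtH).
  have -> : a + n.+1%:R * c = n.+1%:R * (c + a / n.+1%:R) by field.
  rewrite mulnC exprM -exprZn.
  move/(filt_hom_hom_root (gnorm_filtration lvl hchi) (ltn0Sn n)).
  move=> /(_ (gnorm_filt_dom hchi HSR))/(homogenizeP lvl hchi _ HSR).
  by rewrite hc lee_fin gerDl leNgt divr_gt0.
Qed.

Variables (G : R -> set K) (maxG : filt_max G).
Hypothesis (FG : forall a, section_filt a `<=` G a).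

Lemma section_filt_dom n t : sections L (n * m) t -> filt_dom G (t / s ^+ n).
Proof.
move=> Ht; have dnm : (d %| n * m)%N by apply: dvdn_mull.
have [a Ha] := gnorm_filt_dom hchi (section_ring_monomial dnm Ht).
exists (a - n%:R * c); apply: FG; exists n.
by rewrite subrK divfK ?expf_neq0//; apply: (filt_sub_hom (gnorm_filtration lvl hchi)).
Qed.

Lemma section_filt_const a : a != 0 -> filt_val G (iota a) = 0%E.
Proof.
have ge0 b : b != 0 -> (0 <= filt_val G (iota b))%E.
  move=> b0; apply/(filt_valP maxG)/FG; exists 0%N.
  rewrite mul0r addr0 expr0 mulr1 mul0n.
  apply/(homogenizeP lvl hchi); last by rewrite (homogenize_const lvl hchi).
  by apply: section_ring_monomial => //; apply: sections_const.
move=> a0; have := ge0 _ a0; have := ge0 a^-1; rewrite invr_eq0 => /(_ a0).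
have dom b : b != 0 -> filt_dom G (iota b).
  by move=> b0; exists 0; apply/(filt_valP maxG)/ge0.
have : (filt_val G (iota a) + filt_val G (iota a^-1%R) = 0)%E.
  rewrite -filt_valM//; [|exact: dom|by apply: dom; rewrite invr_eq0].
  by rewrite -rmorphM mulfV// rmorph1 filt_val1.
case: (filt_val G (iota a)) => [y| |]//; case: (filt_val G (iota a^-1%R)) => [z| |]//.
rewrite -EFinD !lee_fin => -[yz] z0 y0; congr (_%:E).
by apply/le_anti/andP; split => //; rewrite -yz lerDl.
Qed.

(** The sections t and s, of different degrees, are compared through a rational
    function. *)
Lemma section_filt_compare m' t b : (d %| m')%N -> sections L m' t ->
  (b%:E <= chi (t *: 'X^m'))%E -> G (m%:R * b - m'%:R * c) (t ^+ m / s ^+ m').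
Proof.
move=> dm' Ht bt; apply: FG; exists m'.
rewrite subrK divfK ?expf_neq0// exprM -exprZn; apply: (filtX filtH) => //.
apply: (filt_sub_hom (gnorm_filtration lvl hchi)).
by split => //; apply: section_ring_monomial.
Qed.

End FixedSection.

(** The infimum defining IN (FS chi) at s is attained at a point of X^an given
    by a maximal filtration above [section_filt]. *)
Lemma exists_valuation m s : (0 < m)%N -> (D %| m)%N -> sections L m s -> s != 0 ->
  exists v : berkovich X R,
    (sect_val L v m s + (m%:R * FS L chi v)%:E <= homogenize chi (s *: 'X^m))%E.
Proof.
move=> m_gt0 Dm Hs s0.
have dm : (d %| m)%N by apply: dvdn_trans Dm; apply: dvdn_mulr.
have [c hc] : exists c, homogenize chi (s *: 'X^m) = c%:E.
  by have /fineK <- := homogenize_fin lvl hchi m_gt0 dm Hs s0; eexists.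
rewrite hc.
have [G maxG FG] := exists_filt_max (section_filtration Dm Hs hc).
(* The ring of G contains the functions on X \ (s = 0), and the coordinate x j
   does not vanish at the kernel of G. *)
have [a em] : exists a, m = (a * m0)%N.
  by apply/dvdnP; apply: dvdn_trans Dm; apply: dvdn_mull.
have a_gt0 : (0 < a)%N by move: m_gt0; rewrite em muln_gt0 => /andP[].
have vconst := section_filt_const maxG FG.
have [dom1 domB domM] := filt_dom_subring maxG.
have algG : is_subalg iota (filt_dom G).
  split=> // b; have [->|b0] := eqVneq b 0.
    by rewrite rmorph0; exists 0; apply: (filt0 maxG.1).
  by apply/(filt_val_dom maxG); rewrite vconst.
have Hs' : H0 (qbase L) (a * e) s by move: Hs; rewrite /sections em line_multM.
have x_neq0 := emb_neq0 x_unit.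
have s_chart j : x j != 0 -> chart iota x j (s / x j ^+ a).
  by move=> xj0; apply: (H0_chart Hx x_unit x_model R Hs' xj0).
have forms_dom g : forms iota x a g -> filt_dom G (g / s).
  move=> Sg; rewrite -[s]expr1; apply: (section_filt_dom Dm s0 FG).
  by rewrite mul1n /sections em line_multM//; apply: H0_forms Sg.
have [j Hj] := coord_notin_prime x_neq0 algG
  (filt_kernel_prime algG maxG (fun f => id)) a_gt0 s0 s_chart forms_dom.
have xjs_dom : filt_dom G (x j ^+ a / s).
  apply: forms_dom; have := forms_coordX j a (forms1 iota x).
  by rewrite addn0 mulr1.
have [xjs0 xjs_inv] := filt_dom_inv maxG xjs_dom
  (fun v_xjs => Hj (conj xjs_dom v_xjs)).
have xj0 : x j != 0.
  apply: contraNneq xjs0 => ->; by rewrite expr0n gtn_eqF// mul0r.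
(* Hence the point lies in the j-th chart, all of whose functions belong to the
   ring of G because s / x j ^+ a does. *)
pose A := chart iota x j.
have algA : is_subalg iota A := chart_subalg iota x j.
have AG : A `<=` filt_dom G.
  apply: smallest_sub => // _ [l _ <-].
  have -> : x l / x j = (x l * x j ^+ a.-1 / s) * (x j ^+ a / s)^-1.
    rewrite -{2}(prednK a_gt0) exprS; field.
    by rewrite s0 xj0 expf_neq0.
  apply: domM => //; apply: forms_dom; rewrite -{1}(prednK a_gt0).
  apply: forms_coord; have := forms_coordX j a.-1 (forms1 iota x).
  by rewrite addn0 mulr1.
have [pO Uj] := emb_frame Hx x_unit x_model xj0 (filt_kernel_prime algA maxG AG).
have [v [vO vG]] := berkovich_of_filtration maxG algA AG vconst pO.
rewrite -vO in pO Uj.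
have algO := point_subalg pO.
have AO : A `<=` bring v.
  by rewrite vO; apply: (sub_localize algA (filt_kernel_prime algA maxG AG)).
exists v; set O := bring v in pO Uj algO AO *.
pose cv := berk_center v; have pc : points cv by case: (berk_centerP v).
have cO : cv `<=` O := @center_sub _ _ _ v.
(* The value of s at v is finite, as s / x j ^+ a is invertible at v, and x j is
   a frame; the frame at the center of v is also a frame at v. *)
have UA : is_unit_in O (s / x j ^+ a).
  apply: bval_unit; first exact: AO (s_chart _ xj0).
  rewrite vG; last exact: AO (s_chart _ xj0).
  move=> E; have : filt_val G (s / x j ^+ a * (x j ^+ a / s)) = +oo%E.
    rewrite filt_valM//; last exact: AG (s_chart _ xj0).
    by rewrite E; have /(filt_val_dom maxG) := xjs_dom; case: (filt_val _ _).
  by rewrite -invf_div mulVf ?filt_val1.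
have Us : is_unit_in O (s / frame (qbase L) cv ^+ line_mult L m).
  have fO := frame_neq0 (qbase L) pO; have fc := frame_neq0 (qbase L) pc.
  have -> : s / frame (qbase L) cv ^+ line_mult L m = (s / x j ^+ a) *
      (x j / frame (qbase L) O ^+ e) ^+ a *
      (frame (qbase L) cv / frame (qbase L) O)^-1 ^+ (e * a).
    rewrite em line_multM// -/e [(a * e)%N]mulnC invf_div !expr_div_n !exprM.
    by field; rewrite !expf_neq0.
  apply: (unit_inM algO); first apply: (unit_inM algO) => //.
    exact: (unit_inX algO).
  by apply/(unit_inX algO)/unit_inV/frame_sub.
have /fineK := bval_fin_num Us; rewrite -/(sect_val L v m s).
set u := fine _ => eu; rewrite -eu -EFinD lee_fin.
have mR : 0 < m%:R :> R by rewrite ltr0n.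
rewrite -lerBrDl -ler_pdivlMl//.
(* It remains to compare an arbitrary section t with s, both being raised to a
   common degree. *)
apply: (FS_le m0_gt0 m0_den Hx x_unit lvl hchi) => m' t m'_gt0 Dm' Ht t0.
have dm' : (d %| m')%N by apply: dvdn_trans Dm'; apply: dvdn_mulr.
have qm := dvdn_trans lvl.2 dm; have qm' := dvdn_trans lvl.2 dm'.
have Ow : O (t / frame (qbase L) cv ^+ line_mult L m').
  exact/cO/section_center.
have efrac : t ^+ m / s ^+ m' = (t / frame (qbase L) cv ^+ line_mult L m') ^+ m *
    (s / frame (qbase L) cv ^+ line_mult L m)^-1 ^+ m'.
  have fc := frame_neq0 (qbase L) pc.
  rewrite invf_div !expr_div_n -!exprM.
  have -> : (line_mult L m' * m = line_mult L m * m')%N.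
    by rewrite mulnC -line_multM// mulnC line_multM// mulnC.
  by field; rewrite !expf_neq0.
have OV := unit_inV Us; have [_ Ou _] := OV.
have val_frac : filt_val G (t ^+ m / s ^+ m') =
    (m%:R%:E * sect_val L v m' t + (m'%:R * - u)%:E)%E.
  rewrite efrac -vG; last by apply: (subalgM algO); apply: (subalgX algO).
  rewrite bvalM; [|exact: (subalgX algO)|exact: (subalgX algO)].
  by rewrite !bvalX// bvalV// -/(sect_val L v m s) -eu.
have := gnorm_ninfty hchi (section_ring_monomial dm' Ht).
have := gnorm_pinfty hchi (section_ring_monomial dm' Ht).
case echi : (chi (t *: 'X^m')) => [b| |]//; last first.
  move=> [/(_ erefl) + _]; move/eqP; rewrite scaler_eq0 (negPf t0)/=.
  by rewrite -size_poly_eq0 size_polyXn.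
move=> _ _.
have := section_filt_compare m_gt0 s0 FG dm' Ht (b := b); rewrite echi lexx.
move=> /(_ erefl)/(filt_valP maxG); rewrite val_frac /log_abs.
have := sect_val_ge0 v Ht; case: (sect_val L v m' t) => [w| |]//= _.
  rewrite -EFinM -!EFinD !lee_fin => le1.
  by rewrite mulrCA ler_pdivlMl//; lra.
by move=> _; rewrite addNye leNye.
Qed.

End Attainment.

Theorem theorem2p16 (k : closedFieldType) (X : projVariety k)
    (L : qLineBundle X) (hL : ample L) (R : realType)
    (chi : {poly (funField X)} -> \bar R) (hchi : NR L chi) :
  NR_eq L (IN L (FS L chi)) (homogenize chi).
Proof.
have [m0 [m0_gt0 m0_den [N [x [Hx x_unit x_model]]]]] := hL.
have [d lvl gchi] := hchi; have [d_gt0 dL] := lvl.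
exists (d * m0)%N; first by split; [rewrite muln_gt0 d_gt0|apply: dvdn_mulr].
move=> f Hf.
have Hfd : section_ring L d f.
  move=> m; have [f1 f2] := Hf m; split => // dm; apply: f2.
  by apply: contra dm; apply: dvdn_trans; apply: dvdn_mulr.
have val_of := exists_valuation m0_gt0 m0_den Hx x_unit x_model lvl gchi.
have ge_of := homogenize_le_FS m0_gt0 m0_den Hx x_unit lvl gchi.
have [v0 _] : exists v : berkovich X R, True.
  have [j xj0] := emb_neq0 x_unit.
  have [||||v _] := val_of (d * m0)%N (x j ^+ d).
  - by rewrite muln_gt0 d_gt0.
  - by [].
  - exact: (sectionsX d m0_den (Hx j)).
  - exact: expf_neq0.
  by exists v.
rewrite (homogenize_graded lvl gchi Hfd) /IN; apply: eq_bigr => m _.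
have [fm0|fm0] := eqVneq f`_m 0.
  rewrite fm0 scale0r (homogenize0 lvl gchi); apply/eqP; rewrite -leye_eq.
  apply/ereal_infP => _ [v _ <-].
  by rewrite /sect_val mul0r bval0 addye.
have Dm : (d * m0 %| m)%N by apply: contraNT fm0 => /(Hf m).2 ->.
have Hm := (Hf m).1.
have [em|m_gt0] := posnP m; last first.
  apply/le_anti/andP; split; last first.
    by apply/ereal_infP => _ [v _ <-]; apply: ge_of.
  have [v Hv] := val_of _ _ m_gt0 Dm Hm fm0; apply: le_trans Hv.
  by apply: ereal_inf_lbound; exists v.
move: Hm fm0; rewrite em /sections /line_mult div0n => Hm fm0.
have [a ea] := H0_degree0 Hx x_unit x_model R Hm.
have a0 : a != 0 by apply: contraNneq fm0 => a0; rewrite ea a0 rmorph0.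
have val0 v : (sect_val L v 0 f`_0 + (0%:R * FS L chi v)%:E = 0)%E.
  by rewrite /sect_val /line_mult div0n expr0 divr1 ea bval_const// mul0r add0e.
rewrite ea (homogenize_const lvl gchi)//; apply/le_anti/andP; split.
  by apply: ereal_inf_lbound; exists v0 => //; rewrite -ea val0.
by apply/ereal_infP => _ [v _ <-]; rewrite -ea val0.
Qed.
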